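(* Let $c_3$ be a positive constant with the following property (P): for every prime $p$, every integer $1\le m\le p$, every sequence $A$ of $\mathbb{Z}_p$ with $m(A)\le m$ and every integer $l$ with $c_3f(p,m)\le l\le|A|-c_3f(p,m)$ such that $A$ is $l$-incomplete, there exist residues $b,c\in\mathbb{Z}_p$ with $b\ne0$, a subsequence $A^\flat\subset A$ with $|A^\flat|<c_3f(p,m)$ and an integer $l_1\ge l-2f(p,m)$ such that, regarding $A':=b\cdot(A\setminus A^\flat)+c$ as a sequence of integers in $[-(p-1)/2,(p-1)/2]$, the set $\bigcup_{l_1\le l'\le l_1+(pm)^{3/13}}\sum_{l'}(A')$ of integer sums is contained in an interval of length less than $p$. Then there is a positive constant $C$ such that the following holds for all primes $p>C$. Let $A$ be a sequence of $\mathbb{Z}_p$ with $m(A)\le p$ which is $p$-zero-sum-free and satisfies $p+c_3f(p,p)\le|A|\le 2p-2$. Then there are two different elements $a,b\in\mathbb{Z}_p$ and integers $m_a,m_b\ge 0$ with $m_a+m_b\ge 2\big(|A|-p-(c_3+3)f(p,p)\big)$ such that $\{a^{[m_a]},b^{[m_b]}\}\subset A$ (i.e. $a$ occurs at least $m_a$ times and $b$ at least $m_b$ times in $A$).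
   Context: $\mathbb{Z}_p$ is the cyclic group of prime order $p$. A sequence is a finite multiset; $m(A)$ is its maximum multiplicity; subsequences and cardinalities count multiplicity; $x^{[j]}$ means $x$ repeated $j$ times. For an integer $l\le|A|$, $\sum_l(A)=\{\sum_{x\in B}x: B\subset A, |B|=l\}$ (sums in $\mathbb{Z}_p$, or in $\mathbb{Z}$ for integer sequences). $A$ is $l$-incomplete if $\sum_l(A)\ne\mathbb{Z}_p$, and $p$-zero-sum-free if $0\notin\sum_p(A)$. $b\cdot A+c=\{ba+c:a\in A\}$. $f(p,m):=\lfloor (pm)^{6/13}\log^2 p\rfloor$, so $f(p,p)=\lfloor p^{12/13}\log^2p\rfloor$. (The paper proves that a constant $c_3$ with property (P) exists.) *)

(* Defs.v *)
From mathcomp Require Import all_boot all_order all_algebra.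
From mathcomp Require Import finmap multiset.
From mathcomp Require Import all_classical all_reals all_analysis.

Set Implicit Arguments.
Unset Strict Implicit.
Unset Printing Implicit Defensive.

Import Order.TTheory GRing.Theory Num.Theory.

Local Open Scope classical_set_scope.
Local Open Scope mset_scope.
Local Open Scope ring_scope.

(* [ln] is the natural logarithm. *)
Definition f (R : realType) (p m : nat) : int :=
  Num.floor ((p * m)%:R `^ (6 / 13) * ln (p%:R : R) ^+ 2).

Definition max_mult (p : nat) (A : {mset 'F_p}) : nat :=
  \max_(x : 'F_p) A x.

Definition lsums (V : zmodType) (l : nat) (A : {mset V}) : set V :=
  [set s | exists B : {mset V},
     [/\ (B `<=` A)%mset, size B = l & s = \sum_(x <- B) x]].

Definition incomplete (p l : nat) (A : {mset 'F_p}) : Prop :=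
  lsums l A <> setT.

Definition zero_sum_free (p : nat) (A : {mset 'F_p}) : Prop :=
  ~ lsums p A 0.

Definition affine (p : nat) (b c : 'F_p) (A : {mset 'F_p}) : {mset 'F_p} :=
  seq_mset [seq b * x + c | x <- A].

(* For an odd prime p, the representative of x in [-(p-1)/2, (p-1)/2]. *)
Definition centered (p : nat) (x : 'F_p) : int :=
  if (2 * (x : nat) <= p.-1)%N then (x : nat)%:Z else (x : nat)%:Z - p%:Z.

Definition to_int (p : nat) (A : {mset 'F_p}) : {mset int} :=
  seq_mset [seq centered x | x <- A].

(* The sums of l' elements of A', for the integers l' with
   l1 <= l' <= l1 + w, are all defined (l' <= |A'|) and lie in an interval
   [u, v] of length v - u < p.  Without the requirement l' <= |A'| a large l1
   would make the condition void.  As the sums are integers, one may take u and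
   v to be integers.  There are no sums of l' elements for negative l'. *)
Definition sums_in_short_interval (R : realType) (p : nat) (l1 : int) (w : R)
    (A' : {mset int}) : Prop :=
  exists u v : int, v - u < p%:Z /\
    forall l' : nat, l1 <= l'%:Z -> l'%:~R <= l1%:~R + w ->
      (l' <= size A')%N /\ (lsums l' A' `<=` [set s | u <= s <= v])%classic.

(* Integers in [-(p-1)/2, (p-1)/2] represent all the residues modulo p only
   when p is odd.  Moreover f R 2 m = 0 for m <= 2, so for p = 2 (and l = 0)
   no subsequence Ab could have fewer than c3 * f R p m elements. *)
Definition propertyP (R : realType) (c3 : R) : Prop :=
  forall (p m : nat) (A : {mset 'F_p}) (l : nat),
    prime p -> odd p -> (1 <= m <= p)%N -> (max_mult A <= m)%N ->
    c3 * (f R p m)%:~R <= l%:R ->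
    l%:R <= (size A)%:R - c3 * (f R p m)%:~R ->
    incomplete l A ->
    exists (b c : 'F_p) (Ab : {mset 'F_p}) (l1 : int),
      [/\ b != 0,
          (Ab `<=` A)%mset,
          (size Ab)%:R < c3 * (f R p m)%:~R,
          l%:Z - 2 * f R p m <= l1
        & sums_in_short_interval p l1 ((p * m)%:R `^ (3 / 13) : R)
            (to_int (affine b c (A `\` Ab)%mset))].

(* Main.v *)
(* Since p consecutive copies of a translation vanish modulo p, being
   p-zero-sum-free is invariant under affine maps; so A may be replaced by the
   integer sequence A' given by (P) with l = p.  Adding up to (pm)^(3/13)
   elements to a fixed sum of l1 elements of A' moves it by less than p, hence
   all but a few elements of A' lie in [-D, D] with D of order p^(7/13).  This
   is all that is used of (P).  In particular l1 need not be close to p.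

   Restricting to a residue class and dividing, as long as almost all elements
   share a class modulo some d >= 2, makes the sequence generic: many elements
   lie outside every class.  Then few disjoint pairs can be reserved such that
   the sums of half of the reserved elements cover an interval as long as the
   spread.  Swapping the other elements one by one
   moves their sum by at most the spread.  As no p elements may have a sum
   divisible by p, the sums of l (about p) of the non-reserved elements lie
   strictly between two translates of consecutive multiples of p.

   Let n = l + k be the number of non-reserved elements, lo the k-th smallest
   and hi the k-th largest of them.  The largest minus the smallest sum of l
   elements is at least k (hi - lo) plus the number of elements outside
   [lo, hi], and it is less than p, so the average multiplicity of the
   hi - lo + 1 values in [lo, hi] is about k, and two of them have total
   multiplicity about 2 k.  If lo = hi = v, then the distances to v add up to
   less than p.  Then one restricts to a short interval around v and repeats the
   argument: either two values are found as before, or p v being excluded as a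
   sum of p elements forces almost all elements on one side of v, and the values
   v and v + 1 (or v - 1) do. *)

Require Import Defs.
From mathcomp Require Import all_boot all_order all_algebra.
From mathcomp Require Import boolp zify ring lra.

Set Implicit Arguments.
Unset Strict Implicit.
Unset Printing Implicit Defensive.

Import Order.TTheory GRing.Theory Num.Theory.

Local Open Scope ring_scope.

(** * Families of integers without p-term sums divisible by p *)

Lemma int_mulrn (x : int) n : x *+ n = x * n%:Z.
Proof. by rewrite -mulr_natr natz. Qed.

Section IndexedIntegers.
Variable I : finType.
Implicit Types (a b : I -> int) (J R S T U : {set I}).

Definition asum a S : int := \sum_(i in S) a i.

Definition zsf (p : nat) a J :=
  forall S : {set I}, S \subset J -> #|S| = p -> ~~ (p%:Z %| asum a S)%Z.

Definition spread a J (L : nat) :=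
  forall i j, i \in J -> j \in J -> a i - a j <= L%:Z.

Definition generic a J (K : nat) :=
  forall (d : nat) (r : int), (1 < d)%N ->
    (K <= #|[set i in J | ~~ (d%:Z %| (a i - r)%R)%Z]|)%N.

Definition two_values a J (m : int) :=
  exists x y : int, x != y /\
    m <= (#|[set i in J | a i == x]| + #|[set i in J | a i == y]|)%N%:Z.

Lemma subset_of_card J m : (m <= #|J|)%N -> exists2 S : {set I}, S \subset J & #|S| = m.
Proof.
move=> le_mJ; exists [set x in take m (enum J)].
  by apply/subsetP=> x; rewrite inE => /mem_take; rewrite mem_enum.
have /card_uniqP Uc : uniq (take m (enum J)) by rewrite take_uniq ?enum_uniq.
by rewrite cardsE Uc size_take -cardE; case: ltngtP le_mJ.
Qed.

Lemma asumU a S T : [disjoint S & T] -> asum a (S :|: T) = asum a S + asum a T.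
Proof.
by move=> dST; rewrite /asum -bigU //=; apply: eq_bigl => i; rewrite !inE.
Qed.

Lemma asum_affine a b S (q r : int) :
  {in S, forall i, a i = q * b i + r} -> asum a S = q * asum b S + r *+ #|S|.
Proof.
by move=> h; rewrite /asum (eq_bigr _ h) big_split /= mulr_sumr sumr_const.
Qed.

(** In a sum of [p] terms the translation contributes [r] times [p], which vanishes modulo [p]. *)
Lemma zsf_affine p a b J (q r : int) :
  {in J, forall i : I, a i = q * b i + r} -> zsf p a J -> zsf p b J.
Proof.
move=> h za S SJ cS; apply: contra (za S SJ cS) => /dvdzP[k bS].
rewrite (@asum_affine a b S q r); last by move=> i /(subsetP SJ) /h.
by rewrite cS bS -mulr_natr natz mulrA -mulrDl dvdz_mull.
Qed.

Lemma zsf_sub p a J T : T \subset J -> zsf p a J -> zsf p a T.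
Proof. by move=> TJ za S ST; apply: za; apply: subset_trans TJ. Qed.

Lemma card_value_lt p a J v : zsf p a J -> (#|[set i in J | a i == v]| < p)%N.
Proof.
move=> za; rewrite ltnNge; apply/negP => /subset_of_card [S /subsetP SJ cS].
have SJ' : S \subset J by apply/subsetP => i /SJ; rewrite inE => /andP[].
case/negP: (za S SJ' cS).
rewrite (@asum_affine a (fun=> 0) S 0 v); last first.
  by move=> i /SJ; rewrite inE => /andP[_ /eqP ->]; rewrite mul0r add0r.
by rewrite mul0r add0r cS -mulr_natr natz dvdz_mull.
Qed.

Lemma two_values_affine a b J T m (q r : int) : T \subset J -> 0 < q ->
  {in T, forall i, a i = q * b i + r} -> two_values b T m -> two_values a J m.
Proof.
move=> /subsetP TJ q0 h [x [y [nxy hm]]]; exists (q * x + r), (q * y + r); split.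
  by apply: contra nxy => /eqP /addIr /(mulfI _) -> //; lia.
have sub z : (#|[set i in T | b i == z]| <= #|[set i in J | a i == (q * z + r)%R]|)%N.
  apply/subset_leq_card/subsetP => i; rewrite !inE => /andP[iT /eqP bz].
  by rewrite TJ //= h // bz.
apply: le_trans hm _; have := sub x; have := sub y; lia.
Qed.

Lemma two_values_mono a J m m' : m' <= m -> two_values a J m -> two_values a J m'.
Proof. by move=> le [x [y [nxy h]]]; exists x, y; split=> //; apply: le_trans h. Qed.

(* The loss kap * L of each step is halved with the spread L, so that the losses
   add up to at most 2 * kap * L. *)
Lemma reduce_to_generic kap p L a J :
  (0 < p)%N -> spread a J L -> zsf p a J -> (p + 2 * kap * L <= #|J|)%N ->
  exists (J1 : {set I}) (b : I -> int) (q r : int) (L1 : nat),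
    [/\ J1 \subset J, 0 < q & {in J1, forall i, a i = q * b i + r}] /\
    [/\ (0 < L1 <= L)%N, spread b J1 L1, generic b J1 (kap * L1)
      & (#|J| <= #|J1| + 2 * kap * L)%N].
Proof.
move=> p0; elim/ltn_ind: L a J => L IH a J spr za cJ.
have [L0|L0] := posnP L.
  (* With spread 0 all values agree, but fewer than [p] values may be equal. *)
  have /card_gt0P[i0 i0J] : (0 < #|J|)%N by lia.
  have := card_value_lt (a i0) za.
  rewrite (_ : [set i in J | _] = J); first by lia.
  apply/setP => i; rewrite inE; apply: andb_idr => iJ.
  have := spr _ _ iJ i0J; have := spr _ _ i0J iJ; rewrite L0; lia.
have [gen|ngen] := EM (generic a J (kap * L)).
  exists J, a, 1, 0, L; split; split; rewrite ?L0 ?leqnn ?leq_addr //.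
  by move=> i _; rewrite mul1r addr0.
move/existsNP: ngen => [d /existsNP[r /not_implyP[d1 /negP]]].
rewrite -ltnNge => lt_out.
pose T := [set i in J | (d%:Z %| (a i - r)%R)%Z].
have cT : (#|J| = #|T| + #|[set i in J | ~~ (d%:Z %| (a i - r)%R)%Z]|)%N.
  rewrite -(cardsID [set i | (d%:Z %| (a i - r)%R)%Z] J); congr (_ + _)%N.
    by congr #|pred_of_set _|; apply/setP => i; rewrite !inE.
  by congr #|pred_of_set _|; apply/setP => i; rewrite !inE andbC.
pose b i := ((a i - r)%R %/ d)%Z.
have ab : {in T, forall i, a i = d%:Z * b i + r}.
  by move=> i; rewrite inE => /andP[_ dv]; rewrite mulrC divzK // subrK.
have TJ : T \subset J by apply/subsetP => i; rewrite inE => /andP[].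
(* Dividing by [d >= 2] at least halves the spread, so the induction on [L] applies. *)
have half : (2 * L./2 <= L < 2 * L./2 + 2)%N by lia.
have sprT : spread b T L./2.
  move=> i j iT jT; have := spr _ _ (subsetP TJ _ iT) (subsetP TJ _ jT).
  rewrite !ab // => h.
  have : d%:Z * (b i - b j) <= L by lia.
  have [|] := lerP (b i - b j) L./2; first by [].
  by move: (b i - b j) => e; nia.
have [| | |J1 [b1 [q [r1 [L1 [[J1T q0 h1] [L1b spr1 gen1 c1]]]]]]] := IH L./2 _ b T sprT.
- lia.
- exact: zsf_affine ab (zsf_sub TJ za).
- nia.
exists J1, b1, (d%:Z * q), (d%:Z * r1 + r), L1; split; split => //.
- exact: subset_trans TJ.
- by rewrite mulr_gt0 //; lia.
- by move=> i iJ1; rewrite ab ?(subsetP J1T) // h1 //; ring.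
- lia.
- nia.
Qed.
End IndexedIntegers.

(** * Reserved pairs reaching an interval *)

Lemma Zp_intr_eq0 (q : nat) (z : int) : (1 < q)%N ->
  ((z%:~R : 'Z_q) == 0) = (q%:Z %| z)%Z.
Proof.
move=> q1; have nat_case n : ((n%:R : 'Z_q) == 0) = (q %| n)%N.
  by rewrite -val_eqE /= val_Zp_nat //.
rewrite dvdzE /=; case: z => n /=; first by rewrite nat_case.
by rewrite NegzE mulrNz oppr_eq0 nat_case.
Qed.

Section Reach.
Variable I : finType.
Implicit Types (a b : I -> int) (J R S T U : {set I}).

Definition reach a R n (s : int) :=
  exists S : {set I}, [/\ S \subset R, #|S| = n & asum a S = s].

Lemma reachU a R1 R2 n1 n2 s1 s2 : [disjoint R1 & R2] ->
  reach a R1 n1 s1 -> reach a R2 n2 s2 -> reach a (R1 :|: R2) (n1 + n2) (s1 + s2).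
Proof.
move=> dR [S1 [SR1 cS1 <-]] [S2 [SR2 cS2 <-]].
have dS : [disjoint S1 & S2] by apply: disjointWl SR1 _; apply: disjointWr SR2 _.
exists (S1 :|: S2); split; [exact: setUSS | | exact: asumU].
by rewrite cardsU disjoint_setI0 // cards0 subn0 cS1 cS2.
Qed.

Lemma reach1 a R i : i \in R -> reach a R 1 (a i).
Proof.
by move=> iR; exists [set i]; rewrite sub1set cards1 /asum big_set1.
Qed.

Lemma reach_bounds a R n s x L : {in R, forall i, `|a i - x| <= L} ->
  reach a R n s -> `|s - x *+ n| <= L *+ n.
Proof.
move=> bd [S [SR cS <-]]; rewrite -cS -!sumr_const -sumrB.
apply: le_trans (ler_norm_sum _ _ _) _; apply: ler_sum => i iS.
exact: bd (subsetP SR _ iS).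
Qed.

Definition steps a J n (q : int) := exists (R : {set I}) (b : int),
  [/\ R \subset J, #|R| = (2 * n)%N
    & forall j, (j <= n)%N -> reach a R n (b + q *+ j)].

Lemma card_add_pair J R u v : R \subset J :\: [set u; v] -> u \in J -> v \in J ->
  u != v -> [/\ [disjoint [set u; v] & R], [set u; v] :|: R \subset J
              & #|[set u; v] :|: R| = (#|R| + 2)%N].
Proof.
move=> RJ uJ vJ uv.
have dR : [disjoint [set u; v] & R].
  rewrite disjoint_sym; apply: disjointWl RJ _.
  by rewrite disjoint_sym -setI_eq0 setIDA setIC -setIDA setDv setI0.
split=> //.
  rewrite subUset subUset !sub1set uJ vJ /=.
  by apply: subset_trans RJ (subsetDl _ _).
by rewrite cardsU disjoint_setI0 // cards0 subn0 cards2 uv addnC.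
Qed.

(** Disjoint pairs with difference [q] are collected greedily: taking the larger element in [j] of
    them and the smaller one in the others adds [q *+ j]. If the search stops early, no such pair is
    left. *)
Lemma steps_or_free a (q : int) n J : q != 0 ->
  steps a J n q \/ exists J0 : {set I}, [/\ J0 \subset J, (#|J| <= #|J0| + 2 * n)%N
    & {in J0 &, forall u v, a v != a u + q}].
Proof.
move=> q0; elim: n J => [|n IH] J.
  left; exists set0, 0; split; rewrite ?sub0set ?cards0 // => j.
  rewrite leqn0 => /eqP ->; exists set0.
  by rewrite sub0set cards0 /asum big_set0 mulr0n addr0.
have [[u [v [uJ vJ avu]]]|free] :=
    EM (exists u v, [/\ u \in J, v \in J & a v = a u + q]); last first.
  right; exists J; split; rewrite ?leq_addr // => u v uJ vJ.
  by apply/eqP => e; apply: free; exists u, v.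
have uv : u != v by apply: contraNneq q0 => uv; move: avu; rewrite uv; lia.
have cJ : (#|J| = #|J :\: [set u; v]| + 2)%N.
  rewrite -(cardsID [set u; v] J) addnC; congr (_ + _)%N.
  rewrite (setIidPr _) ?cards2 ?uv //.
  by apply/subsetP => i; rewrite !inE => /orP[/eqP->|/eqP->].
have [[R [b [RJ cR stR]]]|[J0 [J0J c0 free]]] := IH (J :\: [set u; v]).
  left; have [dR RJ' cR'] := card_add_pair RJ uJ vJ uv.
  exists ([set u; v] :|: R), (a u + b); split=> //; first by lia.
  move=> j; rewrite -add1n; case: (ltngtP j n.+1) => // [jn _|-> _].
    by rewrite -addrA; apply: reachU => //; [apply: reach1; rewrite !inE eqxx|exact: stR].
  rewrite mulrS addrACA -avu.
  by apply: reachU => //; [apply: reach1; rewrite !inE eqxx orbT|exact: stR].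
right; exists J0; split=> //; last by lia.
exact: subset_trans J0J (subsetDl _ _).
Qed.

(* The set T of reached residues grows whenever a pair (u, v) is added such that
   a u - a v is not a period of T.  If no such pair is left, then all remaining
   elements agree modulo the least period of T, against genericity. *)
Lemma residues_reached a J (q : nat) : (0 < q)%N -> generic a J (2 * q) ->
  exists (R : {set I}) n, [/\ R \subset J, #|R| = (2 * n)%N, (n <= q)%N
    & forall c : int, exists2 s, reach a R n s & (q%:Z %| (s - c)%R)%Z].
Proof.
move=> q0 gen; have [q1|q1] := leqP q 1.
  exists set0, 0%N; split; rewrite ?sub0set ?cards0 // => c; exists 0.
    by exists set0; rewrite sub0set cards0 /asum big_set0.
  by rewrite (_ : q = 1%N) ?dvd1z //; lia.
have cardZ : #|'Z_q| = q by rewrite card_ord Zp_cast.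
pose im R n := [set x : 'Z_q | `[< exists2 s, reach a R n s & s%:~R = x >]].
have grow t : (t < q)%N -> exists (R : {set I}) n,
    [/\ R \subset J, #|R| = (2 * n)%N, (n <= t)%N & (t < #|im R n|)%N].
  elim: t => [_|t IH t1q].
    exists set0, 0%N; split; rewrite ?sub0set ?cards0 //.
    apply/card_gt0P; exists 0; rewrite inE; apply/asboolP; exists 0 => //.
    by exists set0; rewrite sub0set cards0 /asum big_set0.
  have [R [n [RJ cR nt cim]]] := IH (ltnW t1q).
  have [big|small] := ltnP t.+1 #|im R n|.
    by exists R, n; split=> //; apply: leqW.
  have [T Tim] : exists T : {set 'Z_q}, T = im R n by exists (im R n).
  rewrite -Tim in cim small.
  (* The translate of [T] by [h]: the residues obtained by adding one element of residue [h]. *)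
  pose sh (h : 'Z_q) := [set x | x - h \in T].
  have csh h : #|sh h| = #|T|.
    have inj : injective (fun x : 'Z_q => x - h) by exact: addIr.
    rewrite -(card_preimset T inj).
    by congr #|pred_of_set _|; apply/setP => x; rewrite !inE.
  have [[u [v [uJ vJ shuv]]]|same] := EM (exists u v,
      [/\ u \in J :\: R, v \in J :\: R & sh (a u)%:~R != sh (a v)%:~R]).
    have uv : u != v by apply: contraNneq shuv => ->.
    have RJuv : R \subset J :\: [set u; v].
      apply/subsetP => i iR; rewrite !inE (subsetP RJ) // andbT.
      apply/negP => /orP[]/eqP ei.
        by move: uJ; rewrite -ei inE iR.
      by move: vJ; rewrite -ei inE iR.
    have [||dR RJ' cR'] := card_add_pair RJuv _ _ uv.
      by move: uJ; rewrite inE => /andP[].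
      by move: vJ; rewrite inE => /andP[].
    exists ([set u; v] :|: R), (1 + n)%N; split=> //; [lia|].
    have sub w : w \in [set u; v] -> sh (a w)%:~R \subset im ([set u; v] :|: R) (1 + n)%N.
      move=> wuv; apply/subsetP => x; rewrite !inE Tim inE => /asboolP[s hs sx].
      apply/asboolP; exists (a w + s); first by apply: reachU => //; exact: reach1.
      by rewrite rmorphD /= sx addrC subrK.
    (* Both translates are as large as [T] and lie in the new image; had it not grown, all three
       would coincide. *)
    rewrite ltnNge; apply/negP => le; case/negP: shuv.
    have eqU w : w \in [set u; v] -> sh (a w)%:~R = im ([set u; v] :|: R) (1 + n)%N.
      by move=> wuv; apply/eqP; rewrite eqEcard sub // csh; apply: leq_trans le _.
    by rewrite !eqU // !inE eqxx ?orbT.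
  (* The periods form a group, so the least positive one, [d], divides all differences outside [R].
     If [d = 1], then [T] is everything; if [d > 1], genericity fails. *)
  pose per (h : 'Z_q) := forall x, (x + h \in T) = (x \in T).
  have perB h1 h2 : per h1 -> per h2 -> per (h1 - h2).
    by move=> p1 p2 x; rewrite -p2 addrA subrK p1.
  have per0 : per 0 by move=> x; rewrite addr0.
  have perN h : per h -> per (- h) by rewrite -sub0r; apply: perB.
  have perM h k : per h -> per (h *+ k).
    move=> ph; elim: k => [|k IHk]; first by rewrite mulr0n.
    by rewrite mulrS -[_ *+ k]opprK; apply: perB => //; exact: perN.
  have perZ h (k : int) : per h -> per (h *~ k).
    by case: k => k ph; [exact: perM | rewrite NegzE mulrNz; apply/perN/perM].
  have ex_per : exists h : nat, (0 < h)%N && `[< per h%:R >].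
    exists q; rewrite q0; apply/asboolP.
    have -> : (q%:R : 'Z_q) = 0; last by [].
    by apply/eqP; have := Zp_intr_eq0 q q1; rewrite dvdzz.
  have := ex_minnP ex_per; case=> d /andP[d0 /asboolP pd] dmin.
  have d_dvd u v : u \in J :\: R -> v \in J :\: R -> (d%:Z %| (a u - a v)%R)%Z.
    move=> uU vU; have puv : per (a u - a v)%:~R.
      have /eqP e : sh (a u)%:~R == sh (a v)%:~R.
        by apply/negPn/negP => ne; apply: same; exists u, v.
      move=> x; have := congr1 (fun A : {set 'Z_q} => (x + (a u)%:~R) \in A) e.
      by rewrite !inE addrK rmorphB /= addrA => <-.
    have pm : per ((a u - a v)%R %% d)%Z%:~R.
      have -> : ((a u - a v)%R %% d)%Z = (a u - a v) - d%:Z * ((a u - a v)%R %/ d)%Z.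
        by rewrite {2}(divz_eq (a u - a v) d); ring.
      by rewrite rmorphB /= rmorphM /= mulrzr; apply: perB => //; apply: perZ.
    have m0 : 0 <= ((a u - a v)%R %% d)%Z by apply: modz_ge0; lia.
    have md : ((a u - a v)%R %% d)%Z < d by apply: ltz_pmod; lia.
    case E : ((a u - a v)%R %% d)%Z pm m0 md => [m|m] // pm _ md.
    have [m0|m0] := posnP m; first by apply/dvdz_mod0P; rewrite E m0.
    have := dmin m; rewrite m0 /=; have -> : `[< per m%:R >] by apply/asboolP.
    by move=> /(_ isT); lia.
  have [d1|d1] := leqP d 1.
    have pers1 : per 1 by have d_1 : d = 1%N; [lia | rewrite d_1 in pd].
    have /card_gt0P[x0 x0T] : (0 < #|T|)%N by apply: leq_ltn_trans cim.
    have Tfull : T = setT.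
      apply/setP => x; rewrite inE.
      have := perM 1 (x - x0 : 'Z_q) pers1 x0.
      by rewrite natr_Zp addrC subrK x0T.
    by move: small; rewrite Tfull cardsT cardZ; lia.
  have [U0|[u0 u0U]] := set_0Vmem (J :\: R).
    have := gen d 0 d1; rewrite leqNgt => /negP[].
    apply: (@leq_ltn_trans #|J|).
      by apply/subset_leq_card/subsetP => i; rewrite inE => /andP[].
    have /subset_leq_card : J \subset R by rewrite -setD_eq0 U0.
    lia.
  have := gen d (a u0) d1; rewrite leqNgt => /negP[].
  apply: (@leq_ltn_trans #|R|); last by lia.
  apply/subset_leq_card/subsetP => i; rewrite inE => /andP[iJ].
  by apply: contraR => iR; apply: d_dvd; rewrite // inE iR.
have [|R [n [RJ cR nq cim]]] := grow q.-1; first by lia.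
exists R, n; split=> // [|c]; first by lia.
have Tfull : im R n = setT.
  by apply/eqP; rewrite eqEcard subsetT cardsT cardZ; lia.
have : (c%:~R : 'Z_q) \in im R n by rewrite Tfull inE.
rewrite inE => /asboolP[s hs sc]; exists s => //.
by rewrite -Zp_intr_eq0 // rmorphB /= sc subrr.
Qed.
End Reach.

Section Reserve.
Variable I : finType.
Implicit Types (a b : I -> int) (J R S T U : {set I}).

Lemma card_classes (f : I -> nat) J M : {in J, forall i, (f i < M)%N} ->
  #|J| = (\sum_(z < M) #|[set i in J | f i == z :> nat]|)%N.
Proof.
case: M => [|M] fM.
  rewrite big_ord0; apply: eq_card0 => i.
  by apply/negP => /fM.
rewrite -sum1_card (partition_big (fun i => inord (f i) : 'I_M.+1) predT) //=.
apply: eq_bigr => z _; rewrite sum1dep_card; apply: eq_card => i; rewrite !inE.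
by case: (boolP (i \in J)) => //= iJ; rewrite -val_eqE /= inordK // fM.
Qed.

Lemma pigeonhole_class (f : I -> nat) J M N : {in J, forall i, (f i < M)%N} ->
  (M * N < #|J|)%N -> exists z : 'I_M, (N < #|[set i in J | f i == z :> nat]|)%N.
Proof.
move=> fM big; apply/existsP; apply: contraLR big => /existsPn small.
rewrite -leqNgt (card_classes fM) -[M in (_ <= M * N)%N]card_ord -sum_nat_const.
by apply: leq_sum => z _; rewrite leqNgt.
Qed.

Lemma stepsS a J0 J n q : J0 \subset J -> steps a J0 n q -> steps a J n q.
Proof.
by move=> J0J [R [b [RJ cR h]]]; exists R, b; split=> //; apply: subset_trans J0J.
Qed.

(** The differences from 1 to [G] are tried in turn, each failure costing at most [2 * n]
    elements. *)
Lemma steps_or_spaced a n J (G : nat) :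
  (exists2 q : nat, (0 < q <= G)%N & steps a J n q) \/
  exists J0 : {set I}, [/\ J0 \subset J, (#|J| <= #|J0| + 2 * n * G)%N
    & {in J0 &, forall u v, a u != a v -> (G < `|(a u - a v)%R|)%N}].
Proof.
elim: G => [|G [[q /andP[q0 qG] st]|[J0 [J0J c0 sp]]]].
- right; exists J; split; rewrite ?muln0 ?addn0 // => u v _ _.
  by rewrite absz_gt0 subr_eq0.
- by left; exists q => //; rewrite q0 ltnW.
have [//|st|[J1 [J10 c1 free]]] := @steps_or_free I a G.+1%:Z n J0.
  by left; exists G.+1; rewrite ?leqnn //; exact: stepsS st.
right; exists J1; split; [exact: subset_trans J0J | by lia | move=> u v uJ vJ ne].
have := sp _ _ (subsetP J10 _ uJ) (subsetP J10 _ vJ) ne.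
have /eqP := free _ _ uJ vJ; have /eqP := free _ _ vJ uJ; lia.
Qed.

Lemma steps_of_two_values a J n x y : x < y ->
  (2 * n < #|[set i in J | a i == x]|)%N -> (2 * n < #|[set i in J | a i == y]|)%N ->
  steps a J n (y - x).
Proof.
move=> xy cx cy; have [|//|[J0 [J0J c0 free]]] := @steps_or_free I a (y - x) n J.
  by lia.
have hit z : (2 * n < #|[set i in J | a i == z]|)%N -> exists2 i, i \in J0 & a i = z.
  move=> cz; have : (0 < #|[set i in J | a i == z] :&: J0|)%N.
    have := cardsID J0 [set i in J | a i == z].
    have := cardsID J0 J; rewrite (setIidPr J0J).
    have : (#|[set i in J | a i == z] :\: J0| <= #|J :\: J0|)%N.
      by apply/subset_leq_card/setSD/subsetP => i; rewrite inE => /andP[].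
    lia.
  by move=> /card_gt0P[i]; rewrite !inE => /andP[/andP[_ /eqP <-] iJ0]; exists i.
have [i iJ ai] := hit x cx; have [j jJ aj] := hit y cy.
by have := free _ _ iJ jJ; rewrite ai aj addrC subrK eqxx.
Qed.

(* If no difference in [1, G] is popular, then removing few elements leaves only
   values more than G apart, so few of them, and two of these are popular. *)
Lemma popular_step a J L G n K : spread a J L -> (0 < G <= L)%N ->
  (forall x, (K <= #|[set i in J | a i != x]|)%N) ->
  (2 * n * G + (L %/ G).+1 * (2 * n) < K)%N ->
  exists2 q : nat, (0 < q <= L)%N & steps a J n q.
Proof.
move=> spr /andP[G0 GL] gen bK.
have [[q /andP[q0 qG] st]|[J0 [J0J c0 sp]]] := steps_or_spaced a n J G.
  by exists q => //; rewrite q0 (leq_trans qG).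
have c0' x : ((L %/ G).+1 * (2 * n) < #|[set i in J0 | a i != x]|)%N.
  have := gen x; have := cardsID J0 [set i in J | a i != x].
  have := cardsID J0 J; rewrite (setIidPr J0J).
  have -> : [set i in J | a i != x] :&: J0 = [set i in J0 | a i != x].
    apply/setP => i; rewrite !inE andbAC; case: (boolP (i \in J0)) => [iJ0|].
      by rewrite (subsetP J0J).
    by rewrite !andbF.
  have : (#|[set i in J | a i != x] :\: J0| <= #|J :\: J0|)%N.
    by apply/subset_leq_card/setSD/subsetP => i; rewrite inE => /andP[].
  lia.
have /card_gt0P[i0] : (0 < #|[set i in J | a i != 0%R]|)%N by exact: leq_trans (leq_ltn_trans (leq0n _) bK) (gen 0).
rewrite inE => /andP[i0J _].
have [i1 i1J imin] : exists2 i1, i1 \in J & {in J, forall i, a i1 <= a i}.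
  by exists [arg min_(i < i0 in J) a i]%O; case: arg_minP.
(* When the range is cut into pieces of length [G], each piece contains only one value, as distinct
   ones are more than [G] apart; so a crowded piece gives a popular value. *)
have common J1 : J1 \subset J0 -> ((L %/ G).+1 * (2 * n) < #|J1|)%N ->
    exists2 i, i \in J1 & (2 * n < #|[set j in J1 | a j == a i]|)%N.
  move=> J10 c1; have [||z cz] := @pigeonhole_class (fun i => `|(a i - a i1)%R|%N %/ G)%N J1 (L %/ G).+1 (2 * n)%N.
  - move=> i /(subsetP J10) /(subsetP J0J) iJ; rewrite ltnS leq_div2r //.
    have := imin _ iJ; have := spr _ _ iJ i1J; lia.
  - by [].
  have /card_gt0P[i] := leq_ltn_trans (leq0n _) cz.
  rewrite inE => /andP[iJ1 /eqP iz]; exists i => //; apply: leq_trans cz _.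
  apply/subset_leq_card/subsetP => j; rewrite !inE => /andP[jJ1 /eqP jz].
  rewrite jJ1 /=; apply/negPn/negP => ne.
  have := sp _ _ (subsetP J10 _ jJ1) (subsetP J10 _ iJ1) ne.
  have := imin _ (subsetP J0J _ (subsetP J10 _ jJ1)).
  have := imin _ (subsetP J0J _ (subsetP J10 _ iJ1)).
  have := divn_eq `|(a i - a i1)%R|%N G; have := divn_eq `|(a j - a i1)%R|%N G.
  have := ltn_pmod `|(a i - a i1)%R|%N G0; have := ltn_pmod `|(a j - a i1)%R|%N G0.
  rewrite iz jz; move: (`|(a i - a i1)%R| %% G)%N (`|(a j - a i1)%R| %% G)%N (z * G)%N.
  move: (a i) (a j) (a i1) => x y w r1 r2 zG; lia.
have mono J1 z : J1 \subset J0 -> (2 * n < #|[set j in J1 | a j == z]|)%N ->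
    (2 * n < #|[set j in J | a j == z]|)%N.
  move=> J10 h; apply: leq_trans h _; apply/subset_leq_card/subsetP => j.
  by rewrite !inE => /andP[/(subsetP J10) /(subsetP J0J) -> ->].
have [i iJ0 ci] : exists2 i, i \in J0 & (2 * n < #|[set j in J0 | a j == a i]|)%N.
  apply: common; rewrite ?subxx //; apply: leq_trans (c0' 0) _.
  by apply/subset_leq_card/subsetP => i; rewrite inE => /andP[].
have sub1 : [set j in J0 | a j != a i] \subset J0.
  by apply/subsetP => j; rewrite inE => /andP[].
have [k] := common _ sub1 (c0' (a i)).
rewrite inE => /andP[kJ0 ne] /(mono _ _ sub1) ck.
have {}ci := mono _ _ (subxx _) ci.
have iJ := subsetP J0J _ iJ0; have kJ := subsetP J0J _ kJ0.
have [lt|lt|e] := ltgtP (a i) (a k).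
- exists `|(a k - a i)%R|%N; first by have := spr _ _ kJ iJ; lia.
  by rewrite gez0_abs ?subr_ge0 ?(ltW lt) //; exact: steps_of_two_values.
- exists `|(a i - a k)%R|%N; first by have := spr _ _ iJ kJ; lia.
  by rewrite gez0_abs ?subr_ge0 ?(ltW lt) //; exact: steps_of_two_values.
- by rewrite e eqxx in ne.
Qed.

Lemma spread_norm a J L i j : spread a J L -> i \in J -> j \in J -> `|a i - a j| <= L%:Z.
Proof. by move=> spr iJ jJ; have := spr _ _ iJ jJ; have := spr _ _ jJ iJ; lia. Qed.

(* Some of the reserved pairs reach every residue modulo q, the others have
   difference q. *)
Lemma interval_reached a J L G kap : spread a J L -> (0 < L)%N -> (0 < G)%N ->
  (6 * G + 6 * (L %/ G) + 21 <= kap)%N -> generic a J (kap * L) ->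
  exists (R : {set I}) rho y0, [/\ R \subset J, #|R| = (2 * rho)%N, (rho <= 4 * L)%N
    & forall y : int, y0 <= y <= y0 + L%:Z -> reach a R rho y].
Proof.
move=> spr L0 G0 bkap gen.
have K8 : (8 * L <= kap * L)%N by rewrite leq_pmul2r //; apply: (@leq_trans 21) => //; exact: leq_trans (leq_addl _ _) bkap.
pose G1 := minn G L.
have G1b : (0 < G1 <= L)%N by rewrite /G1; lia.
have LG1 : (L %/ G1 <= L %/ G + 1)%N.
  rewrite /G1 /minn; case: ltnP => _; first exact: leq_addr.
  by rewrite divnn L0 addn1.
have genx x : (kap * L <= #|[set i in J | a i != x]|)%N.
  have [J0|[j jJ]] := set_0Vmem [set i in J | a i == x].
    apply: leq_trans (gen 2%N 0 isT) _; apply/subset_leq_card/subsetP => i.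
    rewrite !inE => /andP[iJ _]; rewrite iJ /=.
    by apply/negP => ix; have := in_set0 i; rewrite -J0 inE iJ ix.
  have [jJ' ajx] : j \in J /\ a j = x by move: jJ; rewrite inE => /andP[? /eqP].
  have := gen L.+1 x L0; move/leq_trans; apply.
  apply/subset_leq_card/subsetP => i; rewrite !inE => /andP[-> /=].
  by apply: contra => /eqP ->; rewrite subrr dvdz0.
(* The [3 * L] steps of size [q] must cover the target length [L] and the range [2 * L * n2] of the
   residue sums, where [n2 <= q]. *)
have [|q /andP[q0 qL] [R1 [b [R1J cR1 st]]]] :=
    @popular_step a J L G1 (3 * L) (kap * L) spr G1b genx.
  have : (G1 <= G)%N by rewrite /G1; lia.
  move: LG1 bkap; move: (L %/ G1)%N (L %/ G)%N => x y xy bkap G1G.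
  apply: (@leq_trans ((6 * G + 6 * y + 13) * L)); last by rewrite leq_pmul2r //; lia.
  have : (G1 * L <= G * L)%N by rewrite leq_pmul2r.
  have : (x * L <= (y + 1) * L)%N by rewrite leq_pmul2r.
  lia.
clear bkap LG1 G1b G1.
have gen2 : generic a (J :\: R1) (2 * q).
  move=> d r d1; have := gen d r d1.
  have := cardsID R1 [set i in J | ~~ (d%:Z %| (a i - r)%R)%Z].
  have : (#|[set i in J | ~~ (d%:Z %| (a i - r)%R)%Z] :&: R1| <= #|R1|)%N.
    exact/subset_leq_card/subsetIr.
  have -> : [set i in J | ~~ (d%:Z %| (a i - r)%R)%Z] :\: R1
          = [set i in J :\: R1 | ~~ (d%:Z %| (a i - r)%R)%Z].
    by apply/setP => i; rewrite !inE andbA.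
  lia.
have [R2 [n2 [R2J cR2 n2q res]]] := residues_reached q0 gen2.
have R2J' : R2 \subset J by apply: subset_trans R2J (subsetDl _ _).
have dR : [disjoint R1 & R2].
  rewrite disjoint_sym; apply: disjointWl R2J _.
  by rewrite -setI_eq0 setIDAC setDIl setDv setI0.
have /card_gt0P[i0] : (0 < #|[set i in J | a i != 0%R]|)%N by by apply: leq_trans (genx 0); lia.
rewrite inE => /andP[i0J _].
(* The summand [L%:Z *+ n2] makes [y - b - s] nonnegative for [y] in the interval and every sum [s]
   of [n2] elements of [R2]. *)
exists (R1 :|: R2), (3 * L + n2)%N, (b + a i0 *+ n2 + L%:Z *+ n2); split.
- by rewrite subUset R1J.
- by rewrite cardsU disjoint_setI0 // cards0; lia.
- by lia.
move=> y yb; have [s hs qs] := res (y - b).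
have sb : `|s - a i0 *+ n2| <= L%:Z *+ n2.
  apply: reach_bounds hs => i iR2; apply: spread_norm spr _ i0J.
  exact: (subsetP R2J').
move: qs => /dvdzP[k sk];rewrite !int_mulrn in yb sb.
have k0 : 0 <= - k.
  have : 0 <= - k * q%:Z by lia.
  by rewrite pmulr_lge0.
have k1 : - k <= (3 * L)%N.
  have : - k * q%:Z <= 2 * (L%:Z * n2%:Z) + L by lia.
  have : L%:Z * n2%:Z <= L%:Z * q%:Z by rewrite ler_pM2l.
  have : L%:Z <= L%:Z * q%:Z by rewrite ler_peMr.
  have q0' : 0 < q%:Z by [].
  by move=> *; rewrite -(ler_pM2r q0') PoszM; lia.
have -> : y = (b + q%:Z *+ `|k|%N) + s.
  rewrite int_mulrn; have -> : `|k|%N%:Z = - k by lia.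
  lia.
by apply: reachU => //; apply: st; lia.
Qed.
End Reserve.

(** * Sums of l elements *)

Section Counting.
Variable I : finType.
Implicit Types (a b : I -> int) (J R S T U : {set I}).

Lemma asum_swap a U i j : j \in U -> i \notin U ->
  asum a (i |: (U :\ j)) = asum a U - a j + a i /\ #|i |: (U :\ j)| = #|U|.
Proof.
move=> jU iU; have iUj : i \notin U :\ j by rewrite inE negb_and iU orbT.
rewrite cardsU1 iUj (cardsD1 j U) jU; split=> //.
by rewrite /asum big_setU1 //= (big_setD1 j jU) /=; ring.
Qed.

Lemma swap_sub J U i j : U \subset J -> i \in J -> i |: (U :\ j) \subset J.
Proof.
by move=> UJ iJ; rewrite subUset sub1set iJ; apply: subset_trans UJ; exact: subsetDl.
Qed.

(** Exchanging elements of [U0] for elements of [U1] one by one raises the sum by at most [L] each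
    time; one stops before it first exceeds [tau]. *)
Lemma walk a J L U0 U1 (tau : int) : spread a J L ->
  U0 \subset J -> U1 \subset J -> #|U0| = #|U1| -> asum a U0 <= tau <= asum a U1 ->
  exists U : {set I},
    [/\ U \subset J, #|U| = #|U0| & tau - L%:Z <= asum a U <= tau].
Proof.
move=> spr; move Ed: #|U1 :\: U0| => d.
elim: d U0 Ed => [|d IH] U0 Ed U0J U1J cU /andP[lo hi].
  have UU : U1 = U0.
    by apply/eqP; rewrite eqEcard cU leqnn andbT -setD_eq0 -cards_eq0 Ed.
  exists U0; split=> //; move: hi; rewrite UU; lia.
have /card_gt0P[i] : (0 < #|U1 :\: U0|)%N by rewrite Ed.
rewrite inE => /andP[iU0 iU1].
have /card_gt0P[j] : (0 < #|U0 :\: U1|)%N.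
  have := cardsID U1 U0; have := cardsID U0 U1; rewrite setIC; lia.
rewrite inE => /andP[jU1 jU0].
have [sU cU'] := asum_swap a jU0 iU0.
have := spr i j (subsetP U1J _ iU1) (subsetP U0J _ jU0).
have [le|gt] := lerP (asum a (i |: (U0 :\ j))) tau; last first.
  by move=> ?; exists U0; split=> //; lia.
move=> _; rewrite -cU'; apply: IH; rewrite ?cU' //.
- have -> : U1 :\: (i |: (U0 :\ j)) = (U1 :\: U0) :\ i.
    apply/setP => k; rewrite !inE; have [->|ki] := eqVneq k i; first by [].
    by have [->|kj] := eqVneq k j; first by rewrite (negbTE jU1) !andbF.
  by have := cardsD1 i (U1 :\: U0); rewrite Ed inE iU0 iU1 /=; lia.
- by apply: swap_sub => //; apply: (subsetP U1J).
- by rewrite le hi.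
Qed.

(** Otherwise [walk] gives [p - rho] elements whose sum differs from [t * p] by a number that the
    reserved elements reach, and together these are [p] elements with sum [t * p]. *)
Lemma sums_avoid p a J L R rho y0 U0 U1 (t : int) :
  zsf p a J -> spread a J L -> R \subset J -> (rho <= p)%N ->
  (forall y : int, y0 <= y <= y0 + L%:Z -> reach a R rho y) ->
  U0 \subset J :\: R -> U1 \subset J :\: R ->
  #|U0| = (p - rho)%N -> #|U1| = (p - rho)%N ->
  ~ (asum a U0 + y0 <= t * p%:Z <= asum a U1 + y0).
Proof.
move=> za spr RJ rp rea U0J U1J c0 c1 bd.
have sprD : spread a (J :\: R) L.
  by move=> i j /setDP[iJ _] /setDP[jJ _]; exact: spr.
have [||U [UJ cU sU]] := walk (tau := t * p%:Z - y0) sprD U0J U1J.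
- by rewrite c0 c1.
- lia.
have [|S [SR cS sS]] := rea (t * p%:Z - asum a U); first by lia.
have dSU : [disjoint S & U].
  apply: disjointWl SR _; rewrite disjoint_sym; apply: disjointWl UJ _.
  by rewrite -setI_eq0 setIDAC setDIl setDv setI0.
have SUJ : S :|: U \subset J.
  rewrite subUset (subset_trans SR RJ) /=.
  by apply: subset_trans UJ (subsetDl _ _).
have cSU : #|S :|: U| = p.
  by rewrite cardsU disjoint_setI0 // cards0 subn0 cS cU c0 subnKC.
have /negP[] := za _ SUJ cSU.
by rewrite asumU // sS subrK dvdz_mull.
Qed.

Lemma multiple_between (p : nat) (x : int) : (0 < p)%N ->
  exists t : int, x <= t * p%:Z < x + p%:Z.
Proof.
move=> p0; exists (- (- x %/ p%:Z)%Z).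
have pn : p%:Z != 0 by lia.
have pp : 0 < p%:Z by [].
have := divz_eq (- x) p; have := modz_ge0 (- x) pn; have := ltz_pmod (- x) pp.
move: (- x %/ p%:Z)%Z (- x %% p%:Z)%Z => k r; lia.
Qed.

Lemma card_setC_sum a J (P : pred I) :
  #|[set i in J | P i]|%:Z = \sum_(i in J) (P i)%:Z.
Proof.
rewrite -sum1dep_card big_mkcondr /= -natz natr_sum; apply: eq_bigr => i _.
by case: (P i).
Qed.

Lemma sum_in_sub a J T (x : int) : T \subset J ->
  \sum_(i in J) (if i \in T then a i - x else 0) = asum a T - x *+ #|T|.
Proof.
move=> TJ; rewrite -big_mkcondr /= /asum -sumr_const -sumrB.
by apply: eq_bigl => i; apply: andb_idl; exact: (subsetP TJ).
Qed.

Lemma asum_setD a J U : U \subset J -> asum a J = asum a U + asum a (J :\: U).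
Proof. by move=> UJ; rewrite /asum (big_setID U) /= (setIidPr UJ). Qed.

(** Some value occurs more than [q] times. If no other occurs [q] times, then all but two values
    together take at most [(M - 2) * q] elements, which leaves more than [2 * q] for these two. *)
Lemma two_popular (f : I -> nat) J (M q : nat) : (1 < M)%N ->
  {in J, forall i, (f i < M)%N} -> (M * q < #|J|)%N ->
  exists x y : 'I_M, x != y /\
   (2 * q <= #|[set i in J | f i == x :> nat]| + #|[set i in J | f i == y :> nat]|)%N.
Proof.
move=> M1 fM big; have [x cx] := pigeonhole_class fM big.
pose c (z : 'I_M) := #|[set i in J | f i == z :> nat]|.
have cJ : #|J| = (\sum_(z < M) c z)%N := card_classes fM.
have [[y [yx cy]]|none] := EM (exists y : 'I_M, y != x /\ (q <= c y)%N).
  by exists x, y; rewrite eq_sym; split=> //; move: cx cy; rewrite -/(c x) -/(c y); lia.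
have small y : y != x -> (c y <= q)%N.
  by move=> yx; rewrite leqNgt; apply/negP => /ltnW h; apply: none; exists y.
have [y yx] : exists y : 'I_M, y != x.
  have M0 : (0 < M)%N by apply: ltnW.
  have [x0|x0] := eqVneq x (Ordinal M0); last by exists (Ordinal M0); rewrite eq_sym.
  by exists (Ordinal M1); rewrite x0.
exists x, y; rewrite eq_sym; split=> //; rewrite -/(c x) -/(c y).
move: big; rewrite cJ (bigD1 x) //= (bigD1 y) //=.
have : (\sum_(i < M | (i != x) && (i != y)) c i <= (M - 2) * q)%N.
  have -> : ((M - 2) * q = \sum_(i < M | (i != x) && (i != y)) q)%N.
    rewrite sum_nat_const; congr (_ * _)%N.
    have -> : #|[pred i : 'I_M | (i != x) && (i != y)]| = #|~: [set x; y]|.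
      by apply: eq_card => i; rewrite !inE negb_or.
    by rewrite cardsCs setCK card_ord cards2 eq_sym yx.
  by apply: leq_sum => i /andP[ix _]; exact: small.
have -> : (M * q = (M - 2) * q + 2 * q)%N by rewrite -mulnDl subnK.
move=> hS /leq_trans /(_ (leq_add (leqnn (c x)) (leq_add (leqnn (c y)) hS))).
by move: ((M - 2) * q)%N (c x) (c y) => Q cx' cy'; lia.
Qed.

(** [top] and [bot] tell whether [x] is left out of the smallest and of the largest sum; they are
    booleans because ties at [t] and [s] may fall either way. *)
Lemma outside_weight (top bot : bool) (x s t : int) : s <= t ->
  (top -> t <= x) -> (bot -> x <= s) -> (t < x -> top) -> (x < s -> bot) ->
  let w := (if top then x - t else 0) - (if bot then x - s else 0) in
  1 - ((s <= x) && (x <= t))%:Z <= w /\ (s = t -> `|x - t| <= w).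
Proof.
move=> st; case: top bot => [] [] h1 h2 h3 h4 /=;
  try have {}h1 := h1 isT; try have {}h2 := h2 isT.
- by split; lia.
- have {}h4 : s <= x by rewrite leNgt; apply/negP => /h4.
  by split; lia.
- have {}h3 : x <= t by rewrite leNgt; apply/negP => /h3.
  by split; lia.
- have {}h3 : x <= t by rewrite leNgt; apply/negP => /h3.
  have {}h4 : s <= x by rewrite leNgt; apply/negP => /h4.
  by rewrite h3 h4; split; lia.
Qed.

(** The last hypothesis puts more than [kap * (hi - lo + 1) - (p - l)] elements on the [hi - lo + 1]
    values of the window, on average more than [kap - (p - l)] on each. *)
Lemma two_values_in_window a J (p l kap : nat) (lo hi : int) :
  lo < hi -> (l <= p)%N ->
  l%:Z + kap%:Z - #|[set i in J | (lo <= a i) && (a i <= hi)]|%:Z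
    < p%:Z - kap%:Z * (hi - lo) ->
  two_values a J (2 * (kap%:Z - (p%:Z - l%:Z))).
Proof.
set In := [set i in J | _] => lt_lh lp key.
have [qneg|qpos] := lerP (kap%:Z - (p%:Z - l%:Z)) 0.
  exists 0, 1; split=> //; apply: (@le_trans _ _ 0) => //.
  by rewrite mulr_ge0_le0.
pose M := `|(hi - lo + 1)%R|%N.
have [|||x [y [xy cxy]]] :=
    @two_popular (fun i => `|(a i - lo)%R|%N) In M (kap - (p - l)).
- by clear -lt_lh; rewrite /M; lia.
- by move=> i; rewrite inE => /andP[_ /andP[]]; clear -lt_lh; rewrite /M; lia.
- have : M%:Z = hi - lo + 1 by clear -lt_lh; rewrite /M; lia.
  have : 0 <= (hi - lo) * (p%:Z - l%:Z).
    by apply: mulr_ge0; [clear -lt_lh | clear -lp]; lia.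
  have : (M * (kap - (p - l)))%N%:Z = M%:Z * (kap%:Z - (p%:Z - l%:Z)).
    by rewrite PoszM; congr (_ * _); clear -lp qpos; lia.
  move=> h1 h2 h3; rewrite -ltz_nat h1 h3.
  by move: key h2; move: #|In| => n; clear; lia.
exists (lo + (x : nat)%:Z), (lo + (y : nat)%:Z); split.
  by rewrite (inj_eq (addrI _)).
have sub (z : 'I_M) : (#|[set i in In | `|(a i - lo)%R|%N == z :> nat]| <=
    #|[set i in J | a i == (lo + (z : nat)%:Z)%R]|)%N.
  apply/subset_leq_card/subsetP => i; rewrite !inE => /andP[/andP[-> /andP[si _]] /eqP <-].
  by apply/eqP; clear -si; lia.
have := leq_add (sub x) (sub y); move/(leq_trans cxy).
by move: (_ + _)%N; clear -qpos lp => n; lia.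
Qed.

Lemma short_sums_structure a J (p l kap : nat) :
  #|J| = (l + kap)%N -> (0 < kap < l)%N -> (l <= p)%N ->
  (forall U0 U1, U0 \subset J -> U1 \subset J -> #|U0| = l -> #|U1| = l ->
     asum a U1 - asum a U0 < p%:Z) ->
  two_values a J (2 * (kap%:Z - (p%:Z - l%:Z))) \/
  exists2 i0, i0 \in J &
    [/\ \sum_(i in J) `|a i - a i0| < p%:Z,
        (#|[set i in J | (a i0 < a i)%R]| <= kap)%N
      & (#|[set i in J | (a i < a i0)%R]| <= kap)%N].
Proof.
move=> cJ /andP[k0 kl] lp short.
have [V VJ cV] : exists2 V : {set I}, V \subset J & #|V| = l.
  by apply: subset_of_card; rewrite cJ leq_addr.
pose isl := [pred U : {set I} | (U \subset J) && (#|U| == l)].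
have Vl : isl V by rewrite /= VJ cV eqxx.
have [U0 [U0J c0 min0]] : exists U0 : {set I}, [/\ U0 \subset J, #|U0| = l
    & forall U : {set I}, U \subset J -> #|U| = l -> asum a U0 <= asum a U].
  case: (@arg_minP _ _ _ V isl (asum a) Vl) => U0 /andP[? /eqP ?] h.
  by exists U0; split=> // U UJ cU; apply: h; rewrite /= UJ cU eqxx.
have [U1 [U1J c1 max1]] : exists U1 : {set I}, [/\ U1 \subset J, #|U1| = l
    & forall U : {set I}, U \subset J -> #|U| = l -> asum a U <= asum a U1].
  case: (@arg_maxP _ _ _ V isl (asum a) Vl) => U1 /andP[? /eqP ?] h.
  by exists U1; split=> // U UJ cU; apply: h; rewrite /= UJ cU eqxx.
have cTo : #|J :\: U0| = kap by rewrite cardsD (setIidPr U0J) cJ c0 addKn.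
have cBo : #|J :\: U1| = kap by rewrite cardsD (setIidPr U1J) cJ c1 addKn.
have dom0 i j : i \in J :\: U0 -> j \in U0 -> a j <= a i.
  rewrite inE => /andP[iU0 iJ] jU0; have [s c] := asum_swap a jU0 iU0.
  have := min0 _ (swap_sub j U0J iJ); rewrite c c0 s => /(_ erefl); lia.
have dom1 i j : i \in J :\: U1 -> j \in U1 -> a i <= a j.
  rewrite inE => /andP[iU1 iJ] jU1; have [s c] := asum_swap a jU1 iU1.
  have := max1 _ (swap_sub j U1J iJ); rewrite c c1 s => /(_ erefl); lia.
(* [a t] and [a s] will be the [kap]-th largest and the [kap]-th smallest value. *)
have /card_gt0P[t0 t0To] : (0 < #|J :\: U0|)%N by rewrite cTo.
have [t tTo tmin] : exists2 t, t \in J :\: U0 & forall i, i \in J :\: U0 -> a t <= a i.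
  by exists [arg min_(i < t0 in J :\: U0) a i]%O; case: arg_minP.
have /card_gt0P[s0 s0Bo] : (0 < #|J :\: U1|)%N by rewrite cBo.
have [s sBo smax] : exists2 s, s \in J :\: U1 & forall i, i \in J :\: U1 -> a i <= a s.
  by exists [arg max_(i > s0 in J :\: U1) a i]%O; case: arg_maxP.
have tJ : t \in J by move: tTo; rewrite inE => /andP[].
have sJ : s \in J by move: sBo; rewrite inE => /andP[].
pose w i := (if i \in J :\: U0 then a i - a t else 0)
          - (if i \in J :\: U1 then a i - a s else 0).
(* The sums over the two complements differ by [asum a U1 - asum a U0], which is less than [p]. *)
have sum_w : \sum_(i in J) w i < p%:Z - kap%:Z * (a t - a s).
  rewrite sumrB !sum_in_sub ?subsetDl // cTo cBo.
  rewrite !int_mulrn; have := short _ _ U0J U1J c0 c1.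
  have := asum_setD a U0J; have := asum_setD a U1J; lia.
have inTo i : i \in J -> a t < a i -> i \in J :\: U0.
  by move=> iJ ti; rewrite inE iJ andbT; apply/negP => /(dom0 _ _ tTo); rewrite leNgt ti.
have inBo i : i \in J -> a i < a s -> i \in J :\: U1.
  by move=> iJ ti; rewrite inE iJ andbT; apply/negP => /(dom1 _ _ sBo); rewrite leNgt ti.
have le_st : a s <= a t.
  rewrite leNgt; apply/negP => ts.
  (* A common element would be at least [a s] and at most [a t]; but two disjoint sets of [l]
     elements do not fit into [l + kap]. *)
  have : [disjoint U0 & U1].
    rewrite -setI_eq0; apply/eqP/setP => i; rewrite !inE; apply/negP => /andP[i0 i1].
    by have := le_trans (dom1 _ _ sBo i1) (dom0 _ _ tTo i0); rewrite leNgt ts.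
  move=> dU; have : (#|U0 :|: U1| <= #|J|)%N by apply: subset_leq_card; rewrite subUset U0J.
  by rewrite cardsU disjoint_setI0 // cards0 c0 c1 cJ subn0 leq_add2l leqNgt kl.
have [st|ets] : a s < a t \/ a s = a t.
  by move: le_st; rewrite le_eqVlt => /orP[/eqP|]; [right|left].
  left; pose In := [set i in J | (a s <= a i) && (a i <= a t)].
  have cIn : l%:Z + kap%:Z - #|In|%:Z <= \sum_(i in J) w i.
    have -> : l%:Z + kap%:Z = \sum_(i in J) 1 by rewrite sumr_const natz; lia.
    rewrite (card_setC_sum a) -sumrB; apply: ler_sum => i iJ.
    by have [] := outside_weight le_st (@tmin i) (@smax i) (@inTo i iJ) (@inBo i iJ).
  by apply: (two_values_in_window st lp); apply: le_lt_trans cIn sum_w.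
right; exists t => //; split.
- apply: le_lt_trans (_ : _ <= \sum_(i in J) w i) _; last by move: sum_w; rewrite ets subrr mulr0 subr0.
  apply: ler_sum => i iJ.
  have [_] := outside_weight le_st (@tmin i) (@smax i) (@inTo i iJ) (@inBo i iJ).
  exact.
- by rewrite -cTo; apply/subset_leq_card/subsetP => i; rewrite inE => /andP[iJ]; exact: inTo.
- rewrite -cBo; apply/subset_leq_card/subsetP => i; rewrite inE => /andP[iJ].
  by rewrite -ets; exact: inBo.
Qed.
End Counting.

(** * Two popular values *)

Section Structure.
Variable I : finType.
Implicit Types (a b : I -> int) (J R S T U : {set I}).

Lemma asum_opp a S : asum (fun i => - a i) S = - asum a S.
Proof. by rewrite /asum sumrN. Qed.

Lemma zsf_opp p a J : zsf p a J -> zsf p (fun i => - a i) J.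
Proof. by apply: (@zsf_affine I p a _ J (-1) 0) => i _; ring. Qed.

Lemma two_values_opp a J m : two_values (fun i => - a i) J m -> two_values a J m.
Proof.
move=> [x [y [xy h]]]; exists (- x), (- y); split; first by rewrite eqr_opp.
have e z : [set i in J | a i == (- z)%R] = [set i in J | (- a i)%R == z].
  by apply/setP => i; rewrite !inE eqr_oppLR.
by rewrite !e.
Qed.

(** All elements below [v] are taken, each gaining at least 1, and filled up with elements equal to
    [v]. *)
Lemma low_sum a J (l : nat) (v : int) :
  (#|[set i in J | (v < a i)%R]| + l <= #|J|)%N ->
  (#|[set i in J | (a i < v)%R]| <= l)%N ->
  exists U : {set I}, [/\ U \subset J, #|U| = l
    & asum a U <= v * l%:Z - #|[set i in J | (a i < v)%R]|%:Z].
Proof.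
set P := [set i in J | (v < a i)%R]; set N := [set i in J | (a i < v)%R] => cP cN.
have PJ : P \subset J by apply/subsetP => i; rewrite inE => /andP[].
have NJ : N \subset J by apply/subsetP => i; rewrite inE => /andP[].
have NP : N \subset J :\: P.
  by apply/subsetP => i; rewrite !inE => /andP[-> lt]; rewrite /= -leNgt ltW.
have [V VZ cV] : exists2 V : {set I}, V \subset (J :\: P) :\: N & #|V| = (l - #|N|)%N.
  apply: subset_of_card; rewrite cardsD (setIidPr NP) cardsD (setIidPr PJ).
  by apply: leq_sub2r; rewrite leq_subRL ?subset_leq_card //; lia.
have dNV : [disjoint N & V].
  rewrite disjoint_sym; apply: disjointWl VZ _.
  by rewrite -setI_eq0 setIDAC setDIl setDv setI0.
have cU : #|N :|: V| = l.
  by rewrite cardsU disjoint_setI0 // cards0 subn0 cV subnKC.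
have UJ : N :|: V \subset J.
  rewrite subUset NJ; apply: subset_trans VZ _.
  by apply: subset_trans (subsetDl _ _) (subsetDl _ _).
exists (N :|: V); split=> //.
rewrite asumU // -{1}cU cardsU disjoint_setI0 // cards0 subn0.
have hN : asum a N <= (v - 1) * #|N|%:Z.
  rewrite -int_mulrn -sumr_const; apply: ler_sum => i.
  by rewrite inE => /andP[_]; lia.
have hV : asum a V <= v * #|V|%:Z.
  rewrite -int_mulrn -sumr_const; apply: ler_sum => i /(subsetP VZ).
  by rewrite !inE => /andP[_ /andP[h iJ]]; move: h; rewrite iJ /= -leNgt.
by move: hN hV; rewrite PoszD; move: (asum a N) (asum a V) #|N| #|V|; clear; lia.
Qed.

(** With [P] elements above [v], all but those equal to [v + 1] have distance at least 2, so [v + 1]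
    occurs more than [2 * P - p] times, while [v] occurs fewer than [p] times. *)
Lemma two_values_one_sided p a J (X : nat) (v : int) :
  zsf p a J -> \sum_(i in J) `|a i - v| < p%:Z ->
  (#|[set i in J | (a i < v)%R]| <= X)%N ->
  two_values a J (2 * (#|J|%:Z - p%:Z) - 2 * X%:Z).
Proof.
move=> za sm cN; exists v, (v + 1); split; first by rewrite -subr_eq0 opprD addNKr.
have cZ := card_value_lt v za.
have cJ : #|J|%:Z = #|[set i in J | a i == v]|%:Z + #|[set i in J | (v < a i)%R]|%:Z
    + #|[set i in J | (a i < v)%R]|%:Z.
  rewrite !(card_setC_sum a) -!big_split /= -natz -sumr_const.
  by apply: eq_bigr => i _ /=; case: ltgtP.
have key : 2 * #|[set i in J | (v < a i)%R]|%:Z - #|[set i in J | a i == (v + 1)%R]|%:Z < p%:Z.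
  apply: le_lt_trans sm; rewrite !(card_setC_sum a) mulr_sumr -sumrB.
  by apply: ler_sum => i _; case: (ltgtP (a i) v); case: eqP; lia.
move: cZ cJ key cN; rewrite PoszD.
by move: #|J| #|_| #|_| #|_| #|_|; clear; lia.
Qed.

Lemma two_values_or_concentrated p L G kap a J :
  zsf p a J -> spread a J L -> (0 < G)%N ->
  (6 * G + 6 * (L %/ G) + 21 <= kap)%N ->
  (p + 2 * kap * L + 4 * L < #|J| < 2 * p)%N ->
  two_values a J (2 * (#|J|%:Z - p%:Z) - (4 * kap * L + 16 * L)%N%:Z) \/
  exists (J1 : {set I}) b (q r v : int),
    [/\ J1 \subset J, 0 < q & {in J1, forall i : I, a i = q * b i + r}] /\
    [/\ (#|J| <= #|J1| + 2 * kap * L + 8 * L)%N,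
        \sum_(i in J1) `|b i - v| < p%:Z
      & (#|[set i in J1 | (b i < v)%R]| <= 4 * L ^ 2)%N
        \/ (#|[set i in J1 | (v < b i)%R]| <= 4 * L ^ 2)%N].
Proof.
move=> za spr G0 bkap /andP[cJ1 cJ2].
have p0 : (0 < p)%N by clear -cJ1 cJ2; lia.
have [|J1 [b [q [r [L1 [[J1J q0 ab] [/andP[L10 L1L] spr1 gen c1]]]]]]] :=
  reduce_to_generic p0 spr za (kap := kap); first by clear -cJ1; lia.
have zb : zsf p b J1 by apply: zsf_affine ab (zsf_sub J1J za).
have bkap1 : (6 * G + 6 * (L1 %/ G) + 21 <= kap)%N.
  by apply: leq_trans bkap; rewrite leq_add2r leq_add2l leq_mul2l leq_div2r.
have [R [rho [y0 [RJ cR rhoL rea]]]] := interval_reached spr1 L10 G0 bkap1 gen.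
have cJ1J := subset_leq_card J1J; have cRJ := subset_leq_card RJ.
(* Half of the [2 * rho] reserved elements are used, so [l] others complete [p] terms and [k] are
   left out. *)
pose J2 := J1 :\: R; pose l := (p - rho)%N; pose k := (#|J1| - p - rho)%N.
have cJ2' : #|J2| = (#|J1| - 2 * rho)%N by rewrite cardsD (setIidPr RJ) cR.
have lk : #|J2| = (l + k)%N.
  by rewrite cJ2' /l /k; clear -cJ1 cJ2 c1 cJ1J cRJ cR rhoL L1L; lia.
have kl : (0 < k < l)%N.
  by rewrite /l /k; clear -cJ1 cJ2 c1 cJ1J cRJ cR rhoL L1L; lia.
have lp : (l <= p)%N by rewrite leq_subr.
have rp : (rho <= p)%N by clear -cJ2 cJ1J cRJ cR; lia.
have avoid := sums_avoid zb spr1 RJ rp rea.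
have short U0 U1 : U0 \subset J2 -> U1 \subset J2 -> #|U0| = l -> #|U1| = l ->
    asum b U1 - asum b U0 < p%:Z.
  move=> U0J U1J cU0 cU1; rewrite ltNge; apply/negP => long.
  have [t tb] := multiple_between (asum b U0 + y0) p0.
  apply: (avoid _ _ t U0J U1J cU0 cU1).
  by move: tb long; move: (asum _ _) (asum _ _) => s0 s1; clear; lia.
have J2J1 : J2 \subset J1 by apply: subsetDl.
have J2J := subset_trans J2J1 J1J.
have ab2 : {in J2, forall i : I, a i = q * b i + r}.
  by move=> i iJ2; apply: ab; apply: (subsetP J2J1).
have [tv|[i0 i0J2 [sm cP cN]]] := short_sums_structure lk kl lp short.
  left; apply: two_values_affine J2J q0 ab2 _; apply: two_values_mono tv.
  by rewrite /l /k; clear -cJ1 cJ2 c1 cJ1J cRJ cR rhoL L1L kl rp; lia.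
right; exists J2, b, q, r, (b i0); split; first by [].
split=> //; first by rewrite cJ2'; clear -c1 rhoL L1L cR cRJ; lia.
(* [y0] is itself a sum of [rho] reserved elements, each within [L1] of [b i0]. *)
have y0b : `|y0 - b i0 * rho%:Z| <= (4 * L ^ 2)%N%:Z.
  have : reach b R rho y0 by apply: rea; rewrite lexx lerDl.
  have bd : {in R, forall i, `|b i - b i0| <= L1%:Z}.
    by move=> i iR; apply: spread_norm spr1 (subsetP RJ _ iR) (subsetP J2J1 _ i0J2).
  move/(reach_bounds bd); rewrite !int_mulrn => /le_trans; apply.
  by rewrite -PoszM lez_nat -mulnn mulnA mulnC; apply: leq_mul => //; apply: leq_trans rhoL _; rewrite leq_mul2l.
have kl' : (k <= l)%N by case/andP: kl => _ /ltnW.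
have eP : [set i in J2 | (- b i < - b i0)%R] = [set i in J2 | (b i0 < b i)%R].
  by apply/setP => i; rewrite !inE ltrN2.
have eN : [set i in J2 | (- b i0 < - b i)%R] = [set i in J2 | (b i < b i0)%R].
  by apply/setP => i; rewrite !inE ltrN2.
have [||U0 [U0J cU0 sU0]] := @low_sum b J2 l (b i0).
- by rewrite lk addnC leq_add2l.
- exact: leq_trans cN kl'.
have [||U1 [U1J cU1]] := @low_sum (fun i => - b i) J2 l (- b i0).
- by rewrite eN lk addnC leq_add2l.
- by rewrite eP; apply: leq_trans cP kl'.
rewrite asum_opp eP => sU1.
(* With more than [4 * L ^ 2] elements on both sides, the low and the high sum would enclose
   [b i0 * p - y0], which [avoid] forbids. *)
have [le|gtN] := leqP #|[set i in J2 | (b i < b i0)%R]| (4 * L ^ 2); first by left.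
have [le|gtP] := leqP #|[set i in J2 | (b i0 < b i)%R]| (4 * L ^ 2); first by right.
case: (avoid _ _ (b i0) U0J U1J cU0 cU1).
have bp : b i0 * p%:Z = b i0 * l%:Z + b i0 * rho%:Z.
  by rewrite -mulrDr -PoszD /l subnK.
move: bp gtN gtP sU0 sU1 y0b; move: (4 * L ^ 2)%N #|_| #|_| (asum b U0) (asum b U1) => X N P s0 s1.
rewrite mulNr; move: (b i0 * l%:Z) (b i0 * rho%:Z) (b i0 * p%:Z) => x y z.
by clear; lia.
Qed.

(** In the concentrated case a reflection puts nearly all elements on the upper side of [v]. The
    loss [8 * L ^ 2] restricts this to small [L]. *)
Lemma two_values_small_spread p L G kap a J :
  zsf p a J -> spread a J L -> (0 < G)%N ->
  (6 * G + 6 * (L %/ G) + 21 <= kap)%N ->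
  (p + 2 * kap * L + 4 * L < #|J| < 2 * p)%N ->
  two_values a J
    (2 * (#|J|%:Z - p%:Z) - (4 * kap * L + 16 * L + 8 * L ^ 2)%N%:Z).
Proof.
move=> za spr G0 bkap cJ.
have [tv|] := two_values_or_concentrated za spr G0 bkap cJ.
  by apply: two_values_mono tv; rewrite PoszD; move: (8 * L ^ 2)%N (4 * kap * L + _)%N; clear; lia.
move=> [J1 [b [q [r [v [[J1J q0 ab] [c1 sm few]]]]]]].
have zb : zsf p b J1 by apply: zsf_affine ab (zsf_sub J1J za).
apply: two_values_affine J1J q0 ab _.
have le : 2 * (#|J|%:Z - p%:Z) - (4 * kap * L + 16 * L + 8 * L ^ 2)%N%:Z
    <= 2 * (#|J1|%:Z - p%:Z) - 2 * (4 * L ^ 2)%N%:Z.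
  by move: c1; move: #|J| #|J1| (L ^ 2)%N => n n1 X; rewrite -!mulnA; move: (kap * L)%N; clear; lia.
case: few => few.
  by apply: two_values_mono le _; exact: two_values_one_sided zb sm few.
apply: two_values_opp; apply: two_values_mono le _.
apply: (two_values_one_sided (zsf_opp zb) (v := - v)).
  by under eq_bigr do rewrite -opprD normrN.
by move: few; congr (_ <= _)%N; apply: eq_card => i; rewrite !inE ltrN2.
Qed.

(** In the concentrated case at most [p %/ H.+1] elements are farther than [H] from [v]. The others
    have spread [2 * H], so that repeating the argument makes the quadratic loss depend on [H]
    instead of [L]. *)
Lemma two_values_of_zsf p L G kap H kap' a J :
  zsf p a J -> spread a J L -> (0 < G)%N ->
  (6 * G + 6 * (L %/ G) + 21 <= kap)%N ->
  (12 * H + 27 <= kap')%N ->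
  (p + 2 * kap * L + 8 * L + p %/ H.+1 + 4 * kap' * H + 8 * H < #|J| < 2 * p)%N ->
  two_values a J (2 * (#|J|%:Z - p%:Z)
    - (4 * kap * L + 16 * L + 2 * (p %/ H.+1) + 8 * kap' * H + 32 * H + 32 * H ^ 2)%N%:Z).
Proof.
move=> za spr G0 bkap bkap' /andP[cJ1 cJ2].
have [|tv|] := two_values_or_concentrated za spr G0 bkap (J := J).
- by rewrite cJ2 andbT; apply: leq_ltn_trans cJ1; rewrite -!mulnA; move: (kap * L)%N (p %/ _)%N; clear; lia.
- apply: two_values_mono tv; rewrite -!mulnA; move: (kap * L)%N (kap' * H)%N (p %/ _)%N (H ^ 2)%N.
  by clear; lia.
move=> [J1 [b [q [r [v [[J1J q0 ab] [c1 sm few]]]]]]].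
have zb : zsf p b J1 by apply: zsf_affine ab (zsf_sub J1J za).
pose J2 := [set i in J1 | `|b i - v| <= H%:Z].
have J2J1 : J2 \subset J1 by apply/subsetP => i; rewrite inE => /andP[].
have c2 : (#|J1| <= #|J2| + p %/ H.+1)%N.
  have far : (#|J1 :\: J2| * H.+1 <= p)%N.
    suff : #|J1 :\: J2|%:Z * H.+1%:Z <= p%:Z by [].
    apply: le_trans (ltW sm); rewrite [leRHS](big_setID J2) /=.
    rewrite -[leLHS]add0r; apply: lerD; first by apply: sumr_ge0.
    rewrite mulrC -int_mulrn -sumr_const; apply: ler_sum => i.
    by rewrite !inE => /andP[far iJ1]; move: far; rewrite iJ1 /= -ltNge.
  by have := cardsID J2 J1; rewrite (setIidPr J2J1) => <-; rewrite leq_add2l leq_divRL.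
have spr2 : spread b J2 (2 * H).
  by move=> i j; rewrite !inE => /andP[_ hi] /andP[_ hj]; move: hi hj; clear; lia.
have cJ1J := subset_leq_card J1J; have cJ2J1 := subset_leq_card J2J1.
apply: (two_values_affine (subset_trans J2J1 J1J) q0 (b := b) (r := r)).
  by move=> i /(subsetP J2J1); exact: ab.
have bk : (6 * 1 + 6 * (2 * H %/ 1) + 21 <= kap')%N.
  by rewrite divn1; move: bkap'; clear; lia.
have cJ2' : (p + 2 * kap' * (2 * H) + 4 * (2 * H) < #|J2| < 2 * p)%N.
  move: c1 c2 cJ1 cJ2 cJ1J cJ2J1; rewrite -!mulnA [(kap' * (2 * H))%N]mulnCA.
  by move: (kap * L)%N (kap' * H)%N (p %/ _)%N; clear; lia.
apply: two_values_mono (two_values_small_spread (zsf_sub J2J1 zb) spr2 _ bk cJ2') => //.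
move: c1 c2; rewrite -!mulnA [(kap' * (2 * H))%N]mulnCA expnMn.
by move: (kap * L)%N (kap' * H)%N (p %/ _)%N (H ^ 2)%N; clear; lia.
Qed.
End Structure.

(** * Choice of the parameters *)

Section Scale.
Variable I : finType.
Implicit Types (a : I -> int) (J T : {set I}).

(* The scale y is about p^(1/26): the spread L is of order p^(15/26), which just
   exceeds p^(7/13), and y^24 is about p^(12/13).  With G = y^7 and H = y^4 all
   losses are O(y^23). *)
Lemma two_values_at_scale p y a J :
  (1000 <= y)%N -> (p <= y ^ 27)%N -> zsf p a J -> spread a J (2 * y ^ 15) ->
  (p + y ^ 24 < #|J| < 2 * p)%N ->
  two_values a J (2 * (#|J|%:Z - p%:Z) - (y ^ 24)%N%:Z).
Proof.
move=> y_ge p_le za spr /andP[cJ1 cJ2].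
have y0 : (0 < y)%N by apply: leq_trans y_ge.
have LG : (2 * y ^ 15 %/ y ^ 7 = 2 * y ^ 8)%N.
  by rewrite (expnD y 8 7) mulnA mulnK // expn_gt0 y0.
have pH : (p %/ (y ^ 4).+1 <= y ^ 23)%N.
  apply: leq_trans (leq_div2r _ p_le) _.
  have p4 : (0 < y ^ 4)%N by rewrite expn_gt0 y0.
  apply: leq_trans (leq_div2l _ p4 (leqnSn _)) _.
  by rewrite (expnD y 23 4) mulnK // expn_gt0 y0.
pose kap := (6 * y ^ 7 + 6 * (2 * y ^ 8) + 21)%N.
pose kap' := (12 * y ^ 4 + 27)%N.
have kapL : (kap * (2 * y ^ 15) <= 100 * y ^ 23)%N.
  have -> : (kap * (2 * y ^ 15) = 12 * y ^ 22 + 24 * y ^ 23 + 42 * y ^ 15)%N.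
    by rewrite /kap (expnD y 8 15) (expnD y 7 15); move: (y ^ 8)%N (y ^ 7)%N (y ^ 15)%N; clear; lia.
  have h1 : (y ^ 22 <= y ^ 23)%N by rewrite leq_pexp2l.
  have h2 : (y ^ 15 <= y ^ 23)%N by rewrite leq_pexp2l.
  by move: (y ^ 22)%N (y ^ 15)%N (y ^ 23)%N h1 h2; clear; lia.
have kapH : (kap' * y ^ 4 <= 39 * y ^ 23)%N.
  have -> : (kap' * y ^ 4 = 12 * y ^ 8 + 27 * y ^ 4)%N.
    by rewrite /kap' (expnD y 4 4); move: (y ^ 4)%N; clear; lia.
  have h1 : (y ^ 8 <= y ^ 23)%N by rewrite leq_pexp2l.
  have h2 : (y ^ 4 <= y ^ 23)%N by rewrite leq_pexp2l.
  by move: (y ^ 8)%N (y ^ 4)%N (y ^ 23)%N h1 h2; clear; lia.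
have h15 : (y ^ 15 <= y ^ 23)%N by rewrite leq_pexp2l.
have h4 : (y ^ 4 <= y ^ 23)%N by rewrite leq_pexp2l.
have h8 : ((y ^ 4) ^ 2 <= y ^ 23)%N by rewrite -expnM leq_pexp2l.
(* The losses add up to at most [810 * y ^ 23]. *)
have y24 : (1000 * y ^ 23 <= y ^ 24)%N by rewrite expnS leq_mul2r y_ge orbT.
have G0 : (0 < y ^ 7)%N by rewrite expn_gt0 y0.
have bk : (6 * y ^ 7 + 6 * (2 * y ^ 15 %/ y ^ 7) + 21 <= kap)%N by rewrite LG.
have bk' : (12 * y ^ 4 + 27 <= kap')%N by [].
have cJ : (p + 2 * kap * (2 * y ^ 15) + 8 * (2 * y ^ 15) + p %/ (y ^ 4).+1
   + 4 * kap' * y ^ 4 + 8 * y ^ 4 < #|J| < 2 * p)%N.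
  rewrite cJ2 andbT; apply: leq_ltn_trans cJ1.
  rewrite -(mulnA 2%N kap) -(mulnA 4%N kap').
  move: (kap * _)%N (kap' * _)%N (p %/ _)%N kapL kapH pH => kL kH pD.
  by move: (y ^ 15)%N (y ^ 4)%N (y ^ 23)%N (y ^ 24)%N h15 h4 y24; clear; lia.
apply: two_values_mono (two_values_of_zsf za spr G0 bk bk' cJ).
rewrite lerD2l lerN2 lez_nat -(mulnA 4%N kap) -(mulnA 8%N kap').
move: (kap * _)%N (kap' * _)%N (p %/ _)%N ((y ^ 4) ^ 2)%N kapL kapH pH h8 => kL kH pD y8.
by move: (y ^ 15)%N (y ^ 4)%N (y ^ 23)%N (y ^ 24)%N h15 h4 y24; clear; lia.
Qed.

Lemma few_large p a (W D : nat) : (p <= W * D)%N -> (0 < W)%N ->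
  (forall T, #|T| = W -> asum a T < p%:Z) ->
  (#|[set i | (D%:Z < a i)%R]| < W)%N.
Proof.
move=> pWD W0 short; rewrite ltnNge; apply/negP => /subset_of_card[T TD cT].
have := short T cT; rewrite ltNge => /negP[].
apply: (@le_trans _ _ (W%:Z * D%:Z)); first by rewrite -PoszM lez_nat.
rewrite mulrC -int_mulrn -cT -sumr_const; apply: ler_sum => i /(subsetP TD).
by rewrite inE => /ltW.
Qed.

(** As [y ^ 12 * y ^ 15 >= p], fewer than [y ^ 12] elements exceed [y ^ 15], and likewise for the
    negatives; the rest has spread [2 * y ^ 15]. *)
Lemma two_values_of_short_sums p y a :
  (1000 <= y)%N -> (p <= y ^ 27)%N -> zsf p a [set: I] ->
  (forall T, (#|T| <= y ^ 12)%N -> `|asum a T| < p%:Z) ->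
  (p + 2 * y ^ 24 < #|I| < 2 * p)%N ->
  two_values a [set: I] (2 * (#|I|%:Z - p%:Z) - (2 * y ^ 24)%N%:Z).
Proof.
move=> y_ge p_le za short /andP[c1 c2].
have y0 : (0 < y)%N by apply: leq_trans y_ge.
have W0 : (0 < y ^ 12)%N by rewrite expn_gt0 y0.
have pWD : (p <= y ^ 12 * y ^ 15)%N by rewrite -expnD.
have cP : (#|[set i | ((y ^ 15)%N%:Z < a i)%R]| < y ^ 12)%N.
  by apply: (few_large pWD W0) => T cT; apply: le_lt_trans (ler_norm _) (short T _); rewrite cT.
have cN : (#|[set i | ((y ^ 15)%N%:Z < - a i)%R]| < y ^ 12)%N.
  apply: (few_large (a := fun i => - a i) pWD W0) => T cT.
  by rewrite asum_opp; apply: le_lt_trans (ler_norm _) _; rewrite normrN short // cT.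
pose J := [set i | `|a i| <= (y ^ 15)%N%:Z].
have cJ : (#|I| <= #|J| + 2 * y ^ 12)%N.
  have : (#|~: J| <= #|[set i | ((y ^ 15)%N%:Z < a i)%R]| + #|[set i | ((y ^ 15)%N%:Z < - a i)%R]|)%N.
    apply: leq_trans (leq_card_setU _ _); apply/subset_leq_card/subsetP => i.
    by rewrite !inE -ltNge lter_normr.
  move: cP cN; have := cardsC J; move: #|_| #|_| #|_| (y ^ 12)%N #|_|; clear; lia.
have spr : spread a J (2 * y ^ 15).
  by move=> i j; rewrite !inE; move: (y ^ 15)%N; clear; lia.
have y24 : (1000 * y ^ 12 <= y ^ 24)%N.
  apply: (@leq_trans (y * y ^ 12)); first by rewrite leq_mul2r y_ge orbT.
  by rewrite -expnS leq_pexp2l.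
have JT : J \subset [set: I] by apply/subsetP => i; rewrite inE.
have zJ : zsf p a J := zsf_sub JT za.
have cJI : (#|J| <= #|I|)%N by apply: max_card.
have key := two_values_at_scale y_ge p_le zJ spr _.
apply: (@two_values_affine I a a _ J _ 1 0) => //.
  by move=> i _; rewrite mul1r addr0.
apply: two_values_mono (key _).
  by move: cJ y24; move: #|J| #|_| (y ^ 12)%N (y ^ 24)%N; clear; lia.
by move: cJ y24 cJI c1 c2; move: #|J| #|_| (y ^ 12)%N (y ^ 24)%N; clear; lia.
Qed.
End Scale.

(** [y] is the integer part of the 26th root of [p]; once [y >= 2 ^ 26], one has [p < (y + 1) ^ 26
    <= (2 * y) ^ 26 <= y ^ 27]. *)
Lemma scale_exists (Y : nat) : exists N : nat, forall p, (N <= p)%N ->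
  exists y, [/\ (Y <= y)%N, (y ^ 26 <= p)%N & (p <= y ^ 27)%N].
Proof.
pose Y' := (Y + 2 ^ 26)%N; exists (Y' ^ 26)%N => p Np.
have ex : exists y, (y ^ 26 <= p)%N by exists Y'.
have bd y : (y ^ 26 <= p)%N -> (y <= p)%N.
  by case: y => // y; apply: leq_trans; rewrite -[X in (X <= _)%N]expn1 leq_pexp2l.
case: (ex_maxnP ex bd) => y yp ymax; exists y.
have Y'y : (Y' <= y)%N by apply: ymax.
have y0 : (0 < y)%N by apply: leq_trans Y'y; rewrite addn_gt0 expn_gt0 orbT.
split=> //; first by apply: leq_trans Y'y; apply: leq_addr.
have : (p < y.+1 ^ 26)%N by rewrite ltnNge; apply/negP => /ymax; rewrite ltnn.
move/ltnW/leq_trans; apply.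
apply: (@leq_trans ((2 * y) ^ 26)); first by rewrite leq_exp2r // mul2n -addnn -addn1 leq_add2l.
rewrite expnMn (expnS y 26) leq_mul2r; apply/orP; right.
by apply: leq_trans Y'y; apply: leq_addl.
Qed.

(** * From multisets of residues to indexed families of integers *)

From mathcomp Require Import finmap multiset.
From mathcomp Require Import all_classical all_reals all_analysis.

Local Open Scope mset_scope.
Local Open Scope ring_scope.

(** Positions in [s] serve as indices, so that repeated elements stay distinct and subsequences
    become sets of indices. *)
Lemma lsums_index (T : choiceType) (V : zmodType) (g : T -> V) (s : seq T)
    (S : {set 'I_(size s)}) :
  lsums #|S| (seq_mset [seq g x | x <- s]) (\sum_(i in S) g (tnth (in_tuple s) i)).
Proof.
pose t := [seq g (tnth (in_tuple s) i) | i <- enum S].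
exists (seq_mset t); split.
- apply/msubsetP => x; rewrite !mset_seqE; apply: leq_count_subseq.
  have -> : [seq g x | x <- s] = [seq g (tnth (in_tuple s) i) | i <- enum 'I_(size s)].
    transitivity (map g (map (tnth (in_tuple s)) (enum 'I_(size s)))).
      by rewrite map_tnth_enum.
    by rewrite -map_comp.
  by apply: map_subseq; rewrite [enum 'I_(size s)]enumT; exact: filter_subseq.
- by rewrite (perm_size (perm_eq_seq_mset _)) size_map -cardE.
- by rewrite (perm_big _ (perm_eq_seq_mset _)) big_map big_enum.
Qed.

Lemma lsums_sub (V : zmodType) l (A B : {mset V}) x :
  (A `<=` B)%mset -> lsums l A x -> lsums l B x.
Proof. by move=> AB [C [CA cC ->]]; exists C; split=> //; apply: msubset_trans AB. Qed.

Lemma intr_Fp_eq0 (p : nat) (z : int) : prime p ->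
  (p%:Z %| z)%Z -> (z%:~R : 'F_p) = 0.
Proof.
move=> p_pr /dvdzP[k ->]; rewrite rmorphM /= (_ : p%:~R = 0) ?mulr0 //.
by rewrite -pmulrn pchar_Fp_0.
Qed.

Lemma centeredK (p : nat) (x : 'F_p) : prime p -> (centered x)%:~R = x.
Proof.
move=> p_pr; have p0 := intr_Fp_eq0 p_pr (dvdzz p).
by rewrite /centered; case: ifP => _; rewrite ?rmorphB /= ?p0 ?subr0 -pmulrn natr_Zp.
Qed.

(** [p * p] is at least [y ^ 52], and the logarithm is at least 1. *)
Lemma scale_bounds (R : realType) (p y : nat) :
  (y ^ 26 <= p)%N -> expR 1 <= p%:R :> R ->
  (y ^ 12)%N%:R <= ((p * p)%:R : R) `^ (3 / 13) /\ (y ^ 24)%N%:Z <= f R p p.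
Proof.
move=> yp ep.
have base k : (y ^ (4 * k))%N%:R <= ((p * p)%:R : R) `^ (k%:R / 13).
  have -> : (y ^ (4 * k))%N%:R = ((y ^ 52)%N%:R : R) `^ (k%:R / 13).
    rewrite !natrX -[_ ^+ 52]powR_mulrn // -powRrM -[LHS]powR_mulrn //.
    by congr (_ `^ _); rewrite natrM; field.
  apply: ge0_ler_powR; rewrite ?nnegrE ?divr_ge0 ?ler0n //.
  by rewrite ler_nat (expnD y 26 26) leq_mul.
split; first exact: (base 3%N).
rewrite /f floor_ge_int; apply: le_trans (base 6%N) _.
have ln1 : 1 <= ln (p%:R : R).
  have e0 : 0 < expR 1 :> R by apply: expR_gt0.
  by rewrite -[leLHS]expRK ler_ln // posrE; apply: lt_le_trans ep.
by rewrite ler_peMr ?powR_ge0 // exprn_ege1.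
Qed.

Definition indexed_image (p : nat) (b c : 'F_p) (s : seq 'F_p) (i : 'I_(size s)) :=
  centered (b * tnth (in_tuple s) i + c).

Lemma to_int_affine (p : nat) (b c : 'F_p) (s : seq 'F_p) :
  to_int (affine b c (seq_mset s)) = seq_mset [seq centered (b * x + c) | x <- s].
Proof.
apply/eq_seq_msetP; apply: (perm_trans (perm_map _ (perm_eq_seq_mset _))).
rewrite -map_comp; apply: (perm_trans (perm_map _ (perm_eq_seq_mset _))).
exact: perm_refl.
Qed.

Lemma affine_centered_inj (p : nat) (b c : 'F_p) : prime p -> b != 0 ->
  injective (fun x => centered (b * x + c)).
Proof.
move=> p_pr b0 x y /(congr1 (fun z : int => z%:~R : 'F_p)) /=.
by rewrite !centeredK // => /addIr /(mulfI b0).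
Qed.

(** Modulo [p], a sum of [p] images is [b] times the sum of the residues, as [p] copies of [c]
    cancel; and [b] is invertible. *)
Lemma zsf_index (p : nat) (b c : 'F_p) (s : seq 'F_p) (A : {mset 'F_p}) :
  prime p -> b != 0 -> (seq_mset s `<=` A)%mset -> zero_sum_free A ->
  zsf p (@indexed_image p b c s) [set: 'I_(size s)].
Proof.
move=> p_pr b0 sA zA S _ cS; apply/negP => /(intr_Fp_eq0 p_pr) s0; apply: zA.
apply: lsums_sub sA _; have := lsums_index id S; rewrite map_id cS.
suff -> : \sum_(i in S) tnth (in_tuple s) i = 0 by [].
apply: (mulfI b0); rewrite mulr0 mulr_sumr -[RHS]s0 /asum rmorph_sum /=.
rewrite [RHS](eq_bigr (fun i => b * tnth (in_tuple s) i + c)); last first.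
  by move=> i _; rewrite /indexed_image centeredK.
by rewrite big_split /= sumr_const cS -mulr_natr pchar_Fp_0 // mulr0 addr0.
Qed.

(** Since [l + #|T| <= size s], there are [l] indices outside [T]. Their sum lies in the interval
    with and without [T] added, and the difference is the sum over [T]. *)
Lemma short_sums_index (R : realType) (p l k : nat) (w : R) (b c : 'F_p) (s : seq 'F_p) :
  k%:R <= w ->
  sums_in_short_interval p l%:Z w (to_int (affine b c (seq_mset s))) ->
  forall T : {set 'I_(size s)}, (#|T| <= k)%N ->
    `|asum (@indexed_image p b c s) T| < p%:Z.
Proof.
move=> kw [u [v [uv win]]] T cT; rewrite to_int_affine in win.
have inwin j : (j <= k)%N -> (l + j <= size s)%N /\
    forall S : {set 'I_(size s)}, #|S| = (l + j)%N ->
      u <= asum (@indexed_image p b c s) S <= v.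
  move=> jk; have [||sz sub] := win (l + j)%N.
  - by rewrite lez_nat leq_addr.
  - by rewrite PoszD rmorphD /= lerD2l; apply: le_trans kw; rewrite -pmulrn ler_nat.
  split; first by move: sz; rewrite (perm_size (perm_eq_seq_mset _)) size_map.
  move=> S cS; apply: (sub (asum _ S)); rewrite -cS.
  exact: (lsums_index (fun x => centered (b * x + c)) S).
have [szT winT] := inwin _ cT; have [_ win0] := inwin 0%N (leq0n _).
have [S ST cS] : exists2 S : {set 'I_(size s)}, S \subset ~: T & #|S| = l.
  by apply: subset_of_card; have := cardsC T; rewrite card_ord; lia.
have dST : [disjoint S & T].
  by apply: disjointWl ST _; rewrite -setI_eq0 finset.setIC finset.setICr.
have := win0 S; rewrite addn0 => /(_ cS).
have := winT (S :|: T).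
rewrite cardsU disjoint_setI0 // cards0 subn0 cS => /(_ erefl).
by rewrite asumU //; move: (asum _ _) (asum _ _) uv; clear; lia.
Qed.

Lemma two_values_mset (p : nat) (b c : 'F_p) (s : seq 'F_p) (A : {mset 'F_p}) m :
  prime p -> b != 0 -> (seq_mset s `<=` A)%mset ->
  two_values (@indexed_image p b c s) [set: 'I_(size s)] m ->
  exists (x y : 'F_p) (mx my : nat),
    [/\ x != y, m <= (mx + my)%N%:Z & (msetn mx x `+` msetn my y `<=` A)%mset].
Proof.
move=> p_pr b0 /msubsetP sA [v [w [vw h]]].
pose N v := #|[set i in [set: 'I_(size s)] | indexed_image b c i == v]|.
(* By injectivity all indices with value [z] carry the same residue. *)
have hit z : N z = 0%N \/ exists2 x, centered (b * x + c) = z & (N z <= A x)%N.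
  have [->|/card_gt0P[i]] := posnP (N z); first by left.
  rewrite !inE /= => /eqP iz; right; exists (tnth (in_tuple s) i) => //.
  apply: leq_trans (sA _); rewrite mset_seqE.
  have -> : forall x, count_mem x s =
      count (fun j => tnth (in_tuple s) j == x) (enum 'I_(size s)).
    move=> x; transitivity (count_mem x (map (tnth (in_tuple s)) (enum 'I_(size s)))).
      by rewrite map_tnth_enum.
    exact: count_map.
  rewrite /N cardE [enum 'I_(size s)]enumT size_filter.
  apply: sub_count => j; rewrite !inE /= => /eqP jz; apply/eqP.
  by apply: (affine_centered_inj p_pr b0 (c := c)); exact: etrans jz (esym iz).
have one x n : (n <= A x)%N -> forall y, y != x -> 
    (msetn n x `+` msetn 0 y `<=` A)%mset.
  move=> nA y yx; apply/msubsetP => z; rewrite msetE2 !msetnE.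
  by case: eqP => [->|_]; case: eqP => _; rewrite ?addn0.
(* A value that is not attained is replaced by any other residue, with multiplicity 0. *)
have oth (x : 'F_p) : x + 1 != x by rewrite -subr_eq0 addrAC subrr add0r oner_eq0.
have {}h : m <= (N v + N w)%N%:Z by [].
case: (hit v) => [v0|[x xv cx]].
  case: (hit w) => [w0|[y yw cy]].
    exists 0, 1, 0%N, 0%N; split; first by rewrite eq_sym oner_eq0.
      by rewrite v0 w0 in h.
    by apply: one; rewrite ?oner_eq0.
  exists y, (y + 1), (N w), 0%N; split; first by rewrite eq_sym oth.
    by rewrite v0 in h; rewrite addn0.
  by apply: one; rewrite ?oth.
case: (hit w) => [w0|[y yw cy]].
  exists x, (x + 1), (N v), 0%N; split; first by rewrite eq_sym oth.
    by rewrite w0 in h.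
  by apply: one; rewrite ?oth.
have xy : x != y by apply: contraNneq vw => xy; rewrite -xv -yw xy.
exists x, y, (N v), (N w); split=> //.
apply/msubsetP => z; rewrite msetE2 !msetnE.
have [->|zx] := eqVneq z x; first by rewrite (negbTE xy) addn0.
by have [->|zy] := eqVneq z y.
Qed.

Lemma size_msetB (K : choiceType) (A B : {mset K}) :
  (B `<=` A)%mset -> size A = (size B + size (A `\` B)%mset)%N.
Proof.
move=> /msubsetP BA; rewrite -size_cat; apply/perm_size/allP => x _ /=.
by rewrite count_cat !count_mem_mset msetE2 subnKC.
Qed.

Theorem theorem6p2 (R : realType) (c3 : R) (c3_gt0 : 0 < c3)
    (HP : propertyP c3) :
  exists C : R, 0 < C /\
    forall (p : nat) (A : {mset 'F_p}),
      prime p -> C < p%:R ->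
      (max_mult A <= p)%N ->
      zero_sum_free A ->
      p%:R + c3 * (f R p p)%:~R <= (size A)%:R ->
      (size A <= 2 * p - 2)%N ->
      exists (a b : 'F_p) (ma mb : nat),
        [/\ a != b,
            2 * ((size A)%:R - p%:R - (c3 + 3) * (f R p p)%:~R)
              <= (ma + mb)%:R
          & (msetn ma a `+` msetn mb b `<=` A)%mset].
Proof.
have [N large] := scale_exists 1000.
(* [N] provides the scale [y], [expR 1] makes the logarithm at least 1, and 2 makes [p] odd. *)
exists (N%:R + expR 1 + 2); split.
  by apply: addr_gt0 => //; apply: ltr_wpDl; rewrite ?ler0n ?expR_gt0.
move=> p A p_pr Cp mA zA lbA ubA.
have Np : (N <= p)%N.
  rewrite -(ler_nat R); apply: le_trans (ltW Cp).
  by rewrite -addrA lerDl addr_ge0 // expR_ge0.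
have ep : expR 1 <= p%:R :> R.
  by apply: le_trans (ltW Cp); rewrite addrAC lerDr addr_ge0.
have p2 : (2 < p)%N.
  by rewrite -(ltr_nat R); apply: le_lt_trans Cp; rewrite lerDr addr_ge0 ?expR_ge0.
have p_odd : odd p by have [p_2|] := even_prime p_pr; first by rewrite p_2 in p2.
have [y [y_ge yp py]] := large p Np.
have [Ww Fy] := scale_bounds yp ep.
set F := f R p p in lbA Fy *.
have F0 : 0 <= F by apply: le_trans Fy.
have F0R : 0 <= F%:~R :> R by rewrite ler0z.
have sA_le : (size A)%:R <= 2 * p%:R - 2 :> R.
  have ubA' : (size A + 2 <= 2 * p)%N by move: (size A) ubA p2; clear; lia.
  by move: ubA'; rewrite -(ler_nat R) natrD natrM lerBrDr.
(* If the bound is not positive, multiplicities 0 suffice; otherwise [3 * F < p], which makes [l1]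
   positive below. *)
have [small|big] := lerP (2 * ((size A)%:R - p%:R - (c3 + 3) * F%:~R)) 0.
  exists 0, 1, 0%N, 0%N; split; rewrite // ?(eq_sym 0) ?oner_eq0 //.
  by apply/msubsetP => x; rewrite msetE2 !msetnE !if_same.
have F3 : 3 * F < p%:Z.
  rewrite -(ltr_int R) rmorphM /= -!pmulrn.
  have : 0 <= c3 * F%:~R by rewrite mulr_ge0 // ltW.
  by move: big sA_le; rewrite pmulr_rgt0 // mulrDl; lra.
have [|||||b [c [Ab [l1 [b0 AbA cAb l1l win]]]]] := HP p p A p p_pr p_odd.
- by rewrite leqnn prime_gt0.
- exact: mA.
- by rewrite -/F; move: lbA sA_le; lra.
- by rewrite -/F lerBrDr.
- by move=> e; apply: zA; rewrite /zero_sum_free -[lsums p A]/(lsums p A) e.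
have [l el] : exists l : nat, l1 = l%:Z.
  exists `|l1|%N; rewrite gez0_abs //; apply: le_trans l1l.
  by rewrite -/F; move: F3 F0; clear; lia.
pose s : seq 'F_p := enum_mset (A `\` Ab)%mset.
have sE : seq_mset s = (A `\` Ab)%mset by apply: seq_mset_id.
have sA : (seq_mset s `<=` A)%mset.
  by rewrite sE; apply/msubsetP => x; rewrite msetE2 leq_subr.
rewrite el -sE in win.
have zs := zsf_index c p_pr b0 sA zA.
have short := short_sums_index Ww win.
have cA : size A = (size Ab + size s)%N by apply: size_msetB.
have s_lt : (size s < 2 * p)%N by move: cA ubA p2; move: (size A) (size s); clear; lia.
(* By [big], more than [p + 3 * F] elements remain after the loss of fewer than [c3 * F] to [Ab]. *)
have s_gt : (p + 2 * y ^ 24 < size s)%N.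
  rewrite -ltz_nat; apply: (@le_lt_trans _ _ (p%:Z + 3 * F)).
    by move: Fy; rewrite PoszD PoszM; move: (y ^ 24)%N; clear; lia.
  rewrite -(ltr_int R) rmorphD /= rmorphM /= -!pmulrn.
  move: big cAb; rewrite -/F cA natrD pmulr_rgt0 // mulrDl.
  lra.
have [|x [y1 [mx [my [xy mxy sub]]]]] :=
    two_values_mset p_pr b0 sA (two_values_of_short_sums y_ge py zs short _).
  by rewrite card_ord s_gt.
exists x, y1, mx, my; split=> //.
(* The loss [6 * F] and twice the size of [Ab] make up the term [2 * (c3 + 3) * F] of the bound. *)
have key : 2 * ((size s)%:Z - p%:Z) - 6 * F <= (mx + my)%N%:Z.
  apply: le_trans mxy; rewrite card_ord.
  by move: Fy; rewrite PoszM; move: (y ^ 24)%N; clear; lia.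
move: key; rewrite -(ler_int R) rmorphB /= !rmorphM /= rmorphB /= -!pmulrn.
move: cAb; rewrite -/F cA [(_ + size s)%:R]natrD mulrDl.
lra.
Qed.
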